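(* Let $X$ be a real affine variety and let $\pi':X'\to X$ be the normalization morphism of $X$. Then the canonical injection $\mathbb{R}[X^{R+}]\hookrightarrow\mathbb{R}[X']$ identifies $$ \mathbb{R}[X^{R+}] \simeq \{ p\in\mathbb{R}[X'] \mid \forall z_1,z_2 \in (\pi'_{\mathbb{C}})^{-1}(X(\mathbb{R})),\ \pi'_{\mathbb{C}}(z_1) = \pi'_{\mathbb{C}}(z_2) \implies p_{\mathbb{C}}(z_1) = p_{\mathbb{C}}(z_2) \}.$$
   Context: Rings are commutative with unit. An ideal $I$ of a ring $A$ is real if $\sum a_i^2\in I$ (finite sum) implies that every $a_i\in I$; $\mathrm{R\text{-}Spec}(A)$ is the set of real prime ideals of $A$. For an integral extension $A\hookrightarrow B$, put $A_B^{R+}=\{b\in B\mid \forall \mathfrak{p}\in\mathrm{R\text{-}Spec}(A),\ b_{\mathfrak p}\in A_{\mathfrak p}+\mathrm{Rad}(B_{\mathfrak p})\}$, where $B_{\mathfrak p}=(A\setminus\mathfrak p)^{-1}B$, $b_{\mathfrak p}$ is the image of $b$ in $B_{\mathfrak p}$, and $\mathrm{Rad}$ is the Jacobson radical. A real affine variety is $X=\mathrm{Spec}(\mathbb{R}[X])$ with $\mathbb{R}[X]\simeq\mathbb{R}[x_1,\dots,x_n]/I$ and $I$ a real ideal ($X$ may be reducible). $X(\mathbb{R})\subset\mathbb{R}^n$ is the set of real points and $X(\mathbb{C})\subset\mathbb{C}^n$ the set of complex points. The normalization $X'$ has coordinate ring $\mathbb{R}[X']$, the integral closure of $\mathbb{R}[X]$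 in its total ring of fractions; $\pi'_{\mathbb{C}}:X'(\mathbb{C})\to X(\mathbb{C})$ is the map induced by $\pi'$, and for $p\in\mathbb{R}[X']$, $p_{\mathbb{C}}$ is the induced function on $X'(\mathbb{C})$. The R-seminormalization of $X$ is $X^{R+}=\mathrm{Spec}\big(\mathbb{R}[X]^{R+}_{\mathbb{R}[X']}\big)$, so $\mathbb{R}[X^{R+}]=\mathbb{R}[X]^{R+}_{\mathbb{R}[X']}\subset\mathbb{R}[X']$. *)

(* Defs.v *)
From HB Require Import structures.
From mathcomp Require Import all_boot all_order all_algebra.
From mathcomp Require Import boolp classical_sets reals complex mpoly ring.

Set Implicit Arguments.
Unset Strict Implicit.
Unset Printing Implicit Defensive.

Import GRing.Theory.
Local Open Scope ring_scope.
Local Open Scope quotient_scope.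

(* Rings are [comPzRingType]s, so that the zero ring (hence the empty variety)
   is allowed; this is why MathComp's [idealr], [{ideal_quot _}] and
   [integralOver], which require a nonzero ring, are not used below.
   Ideals are boolean predicates as in MathComp; with the classical axioms of
   [boolp] every subset is of this form. *)

HB.mixin Record isIdealClosed (A : comPzRingType) (I : {pred A}) := {
  idealMl : forall a, {in I, forall u, a * u \in I}
}.

#[short(type="ideal")]
HB.structure Definition Ideal (A : comPzRingType) :=
  {I of GRing.ZmodClosed A I & isIdealClosed A I}.

HB.mixin Record isPrimeClosed (A : comPzRingType) (P : {pred A}) := {
  prime_ideal1 : 1 \notin P;
  prime_idealM : forall a b, a * b \in P -> a \in P \/ b \in P
}.

#[short(type="primeIdeal")]
HB.structure Definition PrimeIdeal (A : comPzRingType) :=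
  {P of Ideal A P & isPrimeClosed A P}.

Definition real_ideal (A : comPzRingType) (I : ideal A) : Prop :=
  forall s : seq A, \sum_(a <- s) a ^+ 2 \in I -> {in s, forall a, a \in I}.

Definition maximal_ideal (A : comPzRingType) (M : ideal A) : Prop :=
  1 \notin M /\
  forall J : ideal A, 1 \notin J -> {subset M <= J} -> {subset J <= M}.

Definition jacobson_radical (A : comPzRingType) : set A :=
  [set a | forall M : ideal A, maximal_ideal M -> a \in M].

Definition ideal_quotient (A : comPzRingType) (I : ideal A) : Type :=
  Quotient.quot I.

Section IdealQuotient.
Variables (A : comPzRingType) (I : ideal A).
Local Notation Q := (ideal_quotient I).

HB.instance Definition _ := GRing.Zmodule.on Q.

Definition quot_proj : A -> Q := \pi_(Quotient.quot I).

Lemma quot_projP x y : quot_proj x = quot_proj y <-> x - y \in I.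
Proof.
rewrite /quot_proj; split=> [/eqP|H]; first by rewrite -Quotient.idealrBE.
by apply/eqP; rewrite -Quotient.idealrBE.
Qed.

Lemma quot_proj_surj (x : Q) : quot_proj (repr (x : Quotient.quot I)) = x.
Proof. exact: reprK. Qed.

Definition quot_one : Q := quot_proj 1.
Definition quot_mul (x y : Q) : Q :=
  quot_proj (repr (x : Quotient.quot I) * repr (y : Quotient.quot I)).

Lemma quot_projM : {morph quot_proj : x y / x * y >-> quot_mul x y}.
Proof.
move=> x y; apply/quot_projP.
set x' := repr _; set y' := repr _.
have Hx : x - x' \in I by apply/quot_projP; rewrite quot_proj_surj.
have Hy : y - y' \in I by apply/quot_projP; rewrite quot_proj_surj.
have -> : x * y - x' * y' = y * (x - x') + x' * (y - y').
  by rewrite !mulrBr addrA [y * x]mulrC [y * x']mulrC addrNK.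
by rewrite rpredD // idealMl.
Qed.

Lemma quot_mulA : associative quot_mul.
Proof.
move=> x y z; rewrite -[x]quot_proj_surj -[y]quot_proj_surj.
by rewrite -[z]quot_proj_surj -!quot_projM mulrA.
Qed.

Lemma quot_mulC : commutative quot_mul.
Proof.
move=> x y; rewrite -[x]quot_proj_surj -[y]quot_proj_surj.
by rewrite -!quot_projM mulrC.
Qed.

Lemma quot_mul1 : left_id quot_one quot_mul.
Proof. by move=> x; rewrite -[x]quot_proj_surj -!quot_projM mul1r. Qed.

Lemma quot_projB : {morph quot_proj : x y / x - y}.
Proof. by move=> x y; rewrite /quot_proj raddfB. Qed.

Lemma quot_projD : {morph quot_proj : x y / x + y}.
Proof. by move=> x y; rewrite /quot_proj raddfD. Qed.

Lemma quot_mulDl : left_distributive quot_mul +%R.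
Proof.
move=> x y z; rewrite -[x]quot_proj_surj -[y]quot_proj_surj.
by rewrite -[z]quot_proj_surj -quot_projD -!quot_projM mulrDl quot_projD.
Qed.

HB.instance Definition _ := GRing.Zmodule_isComPzRing.Build Q
  quot_mulA quot_mulC quot_mul1 quot_mulDl.

HB.instance Definition _ := GRing.isZmodMorphism.Build A Q quot_proj quot_projB.

Lemma quot_proj_monoid : monoid_morphism quot_proj.
Proof. by split=> // x y; rewrite quot_projM. Qed.

HB.instance Definition _ :=
  GRing.isMonoidMorphism.Build A Q quot_proj quot_proj_monoid.

End IdealQuotient.

(* The localization S^-1 A: pairs (a, s), standing for a / s, modulo
   (a, s) ~ (b, t) iff u (a t - b s) = 0 for some u in S. *)
Section Localization.
Variables (A : comPzRingType) (S : mulrClosed A).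

Definition denom : Type := {s : A | s \in S}.
HB.instance Definition _ := Choice.on denom.
Local Notation pair := (A * denom)%type.

Definition loc_rel (x y : pair) : bool :=
  `[< exists2 u, u \in S & u * (x.1 * sval y.2 - y.1 * sval x.2) = 0 >].

Lemma loc_relP x y : reflect
  (exists2 u, u \in S & u * (x.1 * sval y.2) = u * (y.1 * sval x.2))
  (loc_rel x y).
Proof.
apply: (iffP (asboolP _)) => -[u Su E]; exists u => //.
  by apply/subr0_eq; rewrite -mulrBr.
by rewrite mulrBr E subrr.
Qed.

Lemma loc_rel_equiv : equiv_class_of loc_rel.
Proof.
split=> [x|x y|y x z].
- by apply/loc_relP; exists 1; rewrite ?rpred1.
- by apply/loc_relP/loc_relP => -[u Su E]; exists u.
move=> /loc_relP[u Su E] /loc_relP[v Sv F]; apply/loc_relP.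
exists (u * v * sval y.2); first by rewrite !rpredM ?(svalP y.2).
transitivity (v * sval z.2 * (u * (x.1 * sval y.2))); first by ring.
rewrite E; transitivity (u * sval x.2 * (v * (y.1 * sval z.2))); first by ring.
by rewrite F; ring.
Qed.

Canonical loc_rel_canonical := EquivRelPack loc_rel_equiv.
Canonical loc_rel_encModRel := defaultEncModRel loc_rel.

Definition localization : Type := {eq_quot loc_rel}.
HB.instance Definition _ := Choice.on localization.
Local Notation L := localization.

Definition frac (a : A) (s : denom) : L := \pi_({eq_quot loc_rel}) (a, s).
Definition loc_repr (x : L) : pair := repr (x : {eq_quot loc_rel}).

Lemma fracP a s b t : frac a s = frac b t <->
  exists2 u, u \in S & u * (a * sval t) = u * (b * sval s).
Proof.
rewrite /frac; split=> [/eqP|H]; first by rewrite piE => /loc_relP.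
by apply/eqP; rewrite piE; apply/loc_relP.
Qed.

Lemma frac_repr x : frac (loc_repr x).1 (loc_repr x).2 = x.
Proof. by rewrite /frac -surjective_pairing /loc_repr reprK. Qed.

Lemma fracW (P : L -> Prop) : (forall a s, P (frac a s)) -> forall x, P x.
Proof. by move=> PP x; rewrite -[x]frac_repr. Qed.

Definition denom1 : denom := exist _ 1 (rpred1 S).
Definition denomM (s t : denom) : denom :=
  exist _ (sval s * sval t) (rpredM (svalP s) (svalP t)).

Definition loc_zero : L := frac 0 denom1.
Definition loc_one : L := frac 1 denom1.
Definition loc_opp (x : L) : L := let p := loc_repr x in frac (- p.1) p.2.
Definition loc_add (x y : L) : L :=
  let p := loc_repr x in let q := loc_repr y in
  frac (p.1 * sval q.2 + q.1 * sval p.2) (denomM p.2 q.2).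
Definition loc_mul (x y : L) : L :=
  let p := loc_repr x in let q := loc_repr y in
  frac (p.1 * q.1) (denomM p.2 q.2).

Lemma loc_reprE a s : exists2 u, u \in S &
  u * ((loc_repr (frac a s)).1 * sval s) = u * (a * sval (loc_repr (frac a s)).2).
Proof. exact/fracP/frac_repr. Qed.

Lemma loc_oppE a s : loc_opp (frac a s) = frac (- a) s.
Proof.
rewrite /loc_opp; have [u Su] := loc_reprE a s.
case: (loc_repr _) => b t /= E; apply/fracP; exists u => //=.
by rewrite !mulNr !mulrN E.
Qed.

Lemma loc_addE a s b t :
  loc_add (frac a s) (frac b t) = frac (a * sval t + b * sval s) (denomM s t).
Proof.
rewrite /loc_add; have [u Su] := loc_reprE a s; have [v Sv] := loc_reprE b t.
case: (loc_repr (frac a s)) => a' s'; case: (loc_repr (frac b t)) => b' t' /=.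
move=> F E; apply/fracP; exists (u * v); rewrite ?rpredM //=.
transitivity (v * sval t' * sval t * (u * (a' * sval s)) +
              u * sval s' * sval s * (v * (b' * sval t))); first by ring.
by rewrite E F; ring.
Qed.

Lemma loc_mulE a s b t :
  loc_mul (frac a s) (frac b t) = frac (a * b) (denomM s t).
Proof.
rewrite /loc_mul; have [u Su] := loc_reprE a s; have [v Sv] := loc_reprE b t.
case: (loc_repr (frac a s)) => a' s'; case: (loc_repr (frac b t)) => b' t' /=.
move=> F E; apply/fracP; exists (u * v); rewrite ?rpredM //=.
transitivity ((u * (a' * sval s)) * (v * (b' * sval t))); first by ring.
by rewrite E F; ring.
Qed.

Lemma frac_eq a s b t : a * sval t = b * sval s -> frac a s = frac b t.
Proof. by move=> E; apply/fracP; exists 1; rewrite ?rpred1 // E. Qed.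

Lemma loc_addA : associative loc_add.
Proof.
elim/fracW=> a s; elim/fracW=> b t; elim/fracW=> c v.
by rewrite !loc_addE; apply: frac_eq => /=; ring.
Qed.

Lemma loc_addC : commutative loc_add.
Proof.
elim/fracW=> a s; elim/fracW=> b t.
by rewrite !loc_addE; apply: frac_eq => /=; ring.
Qed.

Lemma loc_add0 : left_id loc_zero loc_add.
Proof. by elim/fracW=> a s; rewrite loc_addE; apply: frac_eq => /=; ring. Qed.

Lemma loc_addN : left_inverse loc_zero loc_opp loc_add.
Proof.
elim/fracW=> a s; rewrite loc_oppE loc_addE.
by apply: frac_eq => /=; ring.
Qed.

Lemma loc_mulA : associative loc_mul.
Proof.
elim/fracW=> a s; elim/fracW=> b t; elim/fracW=> c v.
by rewrite !loc_mulE; apply: frac_eq => /=; ring.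
Qed.

Lemma loc_mulC : commutative loc_mul.
Proof.
elim/fracW=> a s; elim/fracW=> b t.
by rewrite !loc_mulE; apply: frac_eq => /=; ring.
Qed.

Lemma loc_mul1 : left_id loc_one loc_mul.
Proof. by elim/fracW=> a s; rewrite loc_mulE; apply: frac_eq => /=; ring. Qed.

Lemma loc_mulDl : left_distributive loc_mul loc_add.
Proof.
elim/fracW=> a s; elim/fracW=> b t; elim/fracW=> c v.
by rewrite !(loc_addE, loc_mulE); apply: frac_eq => /=; ring.
Qed.

HB.instance Definition _ :=
  GRing.isZmodule.Build L loc_addA loc_addC loc_add0 loc_addN.
HB.instance Definition _ := GRing.Zmodule_isComPzRing.Build L
  loc_mulA loc_mulC loc_mul1 loc_mulDl.

Lemma frac0 : 0 = frac 0 denom1 :> L. Proof. by []. Qed.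
Lemma frac1 : 1 = frac 1 denom1 :> L. Proof. by []. Qed.
Lemma fracN a s : - frac a s = frac (- a) s. Proof. exact: loc_oppE. Qed.
Lemma fracD a s b t :
  frac a s + frac b t = frac (a * sval t + b * sval s) (denomM s t).
Proof. exact: loc_addE. Qed.
Lemma fracM a s b t : frac a s * frac b t = frac (a * b) (denomM s t).
Proof. exact: loc_mulE. Qed.

Definition to_loc (a : A) : L := frac a denom1.

Lemma to_loc_zmod : zmod_morphism to_loc.
Proof.
by move=> a b; rewrite /to_loc fracN fracD; apply: frac_eq => /=; ring.
Qed.

Lemma to_loc_monoid : monoid_morphism to_loc.
Proof.
by split=> // a b; rewrite /to_loc fracM; apply: frac_eq => /=; ring.
Qed.

HB.instance Definition _ := GRing.isZmodMorphism.Build A L to_loc to_loc_zmod.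
HB.instance Definition _ :=
  GRing.isMonoidMorphism.Build A L to_loc to_loc_monoid.

End Localization.

Section MultiplicativeSets.
Variables (A B : comPzRingType) (f : {rmorphism A -> B}).

Definition image_mset (S : mulrClosed A) : {pred B} :=
  [pred b | `[< exists2 s, s \in S & f s = b >]].

Lemma image_mset_closed (S : mulrClosed A) : mulr_closed (image_mset S).
Proof.
split; first by apply/asboolP; exists 1; rewrite ?rpred1 ?rmorph1.
move=> b c /asboolP[s Ss <-] /asboolP[t St <-]; apply/asboolP.
by exists (s * t); rewrite ?rpredM ?rmorphM.
Qed.

HB.instance Definition _ (S : mulrClosed A) :=
  GRing.isMulClosed.Build B (image_mset S) (image_mset_closed S).

Definition prime_compl (P : primeIdeal A) : {pred A} := [predC P].

Lemma prime_compl_closed (P : primeIdeal A) : mulr_closed (prime_compl P).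
Proof.
split; first exact: prime_ideal1.
by move=> a b Pa Pb; apply/negP => /prime_idealM[]; apply/negP.
Qed.

HB.instance Definition _ (P : primeIdeal A) :=
  GRing.isMulClosed.Build A (prime_compl P) (prime_compl_closed P).

(* In a commutative ring [GRing.lreg] says "not a zero divisor". *)
Definition regular : {pred A} := [pred a | `[< GRing.lreg a >]].

Lemma regular_closed : mulr_closed regular.
Proof.
split; first exact/asboolP/lreg1.
by move=> a b /asboolP Ra /asboolP Rb; apply/asboolP/lregM.
Qed.

HB.instance Definition _ := GRing.isMulClosed.Build A regular regular_closed.

End MultiplicativeSets.

Arguments regular A : clear implicits.

(* The map S^-1 A -> (f S)^-1 B induced by f. *)
Section LocalizationMap.
Variables (A B : comPzRingType) (f : {rmorphism A -> B}) (S : mulrClosed A).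
Local Notation fS := (image_mset f S).

Lemma image_denom (s : denom S) : f (sval s) \in fS.
Proof. by apply/asboolP; exact: (ex_intro2 _ _ (sval s) (svalP s)). Qed.

Definition map_denom (s : denom S) : denom fS := exist _ (f (sval s)) (image_denom s).

Definition loc_map (x : localization S) : localization fS :=
  frac (f (loc_repr x).1) (map_denom (loc_repr x).2).

Lemma loc_map_frac a s : loc_map (frac a s) = frac (f a) (map_denom s).
Proof.
rewrite /loc_map; have [u Su] := loc_reprE a s.
case: (loc_repr _) => b t /= /(congr1 f); rewrite !rmorphM => E.
by apply/fracP; exists (f u) => //; apply/asboolP; exists u.
Qed.

Lemma loc_map_zmod : zmod_morphism loc_map.
Proof.
elim/fracW=> a s; elim/fracW=> b t; rewrite fracN fracD !loc_map_frac.
by rewrite fracN fracD; apply: frac_eq; rewrite /= rmorphD !rmorphM rmorphN.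
Qed.

Lemma loc_map_monoid : monoid_morphism loc_map.
Proof.
split; first by rewrite frac1 loc_map_frac; apply: frac_eq; rewrite /= rmorph1.
elim/fracW=> a s; elim/fracW=> b t; rewrite fracM !loc_map_frac fracM.
by apply: frac_eq; rewrite /= !rmorphM.
Qed.

HB.instance Definition _ := GRing.isZmodMorphism.Build
  (localization S) (localization fS) loc_map loc_map_zmod.
HB.instance Definition _ := GRing.isMonoidMorphism.Build
  (localization S) (localization fS) loc_map loc_map_monoid.

End LocalizationMap.

(* [Rplus f] is A_B^{R+} for the extension f : A -> B, and
   (A \ P)^-1 B is the localization of B at the image of A \ P. *)
Definition Rplus (A B : comPzRingType) (f : {rmorphism A -> B}) : set B :=
  [set b | forall P : primeIdeal A, real_ideal P ->
    exists x : localization (prime_compl P),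
    exists2 y : localization (image_mset f (prime_compl P)),
      jacobson_radical y & to_loc _ b = loc_map f x + y].

Section IntegralClosure.
Variables (A K : comPzRingType) (f : {rmorphism A -> K}).

Definition integral_over (x : K) : Prop :=
  exists n (c : 'I_n -> A), x ^+ n + \sum_(i < n) f (c i) * x ^+ i = 0.

Definition integral_elts : {pred K} := [pred x | `[< integral_over x >]].

Lemma integral_id a : f a \in integral_elts.
Proof.
apply/asboolP; exists 1%N, (fun=> - a).
by rewrite big_ord1 expr1 expr0 mulr1 rmorphN subrr.
Qed.

End IntegralClosure.

Section IntegralOverNz.
Variables (A K : comNzRingType) (f : {rmorphism A -> K}).

Lemma integral_overP x : integral_over f x <-> integralOver f x.
Proof.
split=> [[n [c E]]|[p p_mon px0]].
  have szc : (size (\poly_(i < n) oapp c 0%R (insub i)) < size ('X^n : {poly A}))%N.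
    by rewrite size_polyXn ltnS size_poly.
  exists ('X^n + \poly_(i < n) oapp c 0%R (insub i)).
    by rewrite monicE lead_coefDl // lead_coefXn.
  rewrite /root rmorphD /= map_polyXn hornerD hornerXn -{}[X in _ == X]E.
  apply/eqP; congr (_ + _).
  rewrite (@horner_coef_wide _ n); last first.
    by rewrite (leq_trans (size_poly _ _)) // size_poly.
  apply: eq_bigr => i _; rewrite coef_map coef_poly ltn_ord insubT //= => lt_i.
  by congr (f (c _) * _); apply: val_inj.
exists (size p).-1, (fun i => p`_i).
have /eqP := px0; rewrite horner_coef size_map_poly_id0; last first.
  by rewrite (monicP p_mon) rmorph1 oner_neq0.
have: (0 < size p)%N by rewrite size_poly_gt0 monic_neq0.
case Ep: (size p) => [//|n] _; rewrite big_ord_recr /= addrC => E.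
rewrite -[RHS]E; congr (_ + _); last by apply: eq_bigr => i _; rewrite coef_map.
have := monicP p_mon; rewrite lead_coefE Ep /= => En.
by rewrite coef_map /= En rmorph1 mul1r.
Qed.

End IntegralOverNz.

Lemma integral_elts_closed (A K : comPzRingType) (f : {rmorphism A -> K}) :
  subring_closed (integral_elts f).
Proof.
have [K0|K0] := eqVneq (1 : K) 0.
  have E (x y : K) : x = y by rewrite -[x]mul1r -[y]mul1r K0 !mul0r.
  have H x : x \in integral_elts f by rewrite (E x (f 0)) integral_id.
  by split.
have A0 : (1 : A) != 0.
  by apply: contraNneq K0 => /(congr1 f); rewrite rmorph1 rmorph0 => ->.
pose A' : comNzRingType :=
  HB.pack (GRing.ComPzRing.sort A)
    (GRing.PzSemiRing_isNonZero.Build (GRing.ComPzRing.sort A) A0).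
pose K' : comNzRingType :=
  HB.pack (GRing.ComPzRing.sort K)
    (GRing.PzSemiRing_isNonZero.Build (GRing.ComPzRing.sort K) K0).
pose f' : {rmorphism A' -> K'} := f.
have H x : (x \in integral_elts f) <-> integralOver f' x.
  by rewrite -integral_overP; split=> /asboolP.
split; first by apply/H; exact: (integral1 f').
  by move=> x y /H Ix /H Iy; apply/H; exact: (integral_sub Ix Iy).
by move=> x y /H Ix /H Iy; apply/H; exact: (integral_mul Ix Iy).
Qed.

Section IntegralClosureRing.
Variables (A K : comPzRingType) (f : {rmorphism A -> K}).

HB.instance Definition _ := GRing.isSubringClosed.Build K (integral_elts f)
  (integral_elts_closed f).

Record integral_closure : Type := IntegralClosure {
  ic_val : K;
  ic_valP : ic_val \in integral_elts f
}.

HB.instance Definition _ := [isSub for ic_val].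
HB.instance Definition _ := [Choice of integral_closure by <:].
HB.instance Definition _ := GRing.SubChoice_isSubComPzRing.Build
  K (integral_elts f) integral_closure (integral_elts_closed f).

Definition to_ic (a : A) : integral_closure := IntegralClosure (integral_id f a).

Lemma to_ic_zmod : zmod_morphism to_ic.
Proof. by move=> a b; apply: val_inj; rewrite /= rmorphB. Qed.

Lemma to_ic_monoid : monoid_morphism to_ic.
Proof.
by split=> [|a b]; apply: val_inj; rewrite /= ?rmorph1 ?rmorphM.
Qed.

HB.instance Definition _ :=
  GRing.isZmodMorphism.Build A integral_closure to_ic to_ic_zmod.
HB.instance Definition _ :=
  GRing.isMonoidMorphism.Build A integral_closure to_ic to_ic_monoid.

End IntegralClosureRing.

Section Normalization.
Variable A : comPzRingType.

Definition total_fractions : comPzRingType := localization (regular A).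

Definition normalization : comPzRingType :=
  integral_closure (@to_loc A (regular A) : {rmorphism A -> total_fractions}).

Definition to_normalization : {rmorphism A -> normalization} :=
  to_ic (@to_loc A (regular A) : {rmorphism A -> total_fractions}).

Lemma to_normalization_inj : injective to_normalization.
Proof.
move=> a b /(congr1 (@ic_val _ _ _)) /fracP[u /asboolP u_reg].
by rewrite /= !mulr1 => /u_reg.
Qed.

Lemma to_normalization_integral x : integral_over to_normalization x.
Proof.
case: x => x Ix; have /asboolP[n [c E]] := Ix.
exists n, c; apply: val_inj; rewrite rmorphD rmorphXn rmorph_sum -[RHS]E.
by congr (_ + _); apply: eq_bigr => i _; rewrite rmorphM rmorphXn.
Qed.

End Normalization.

(* The affine variety X = Spec (R[x_1, .., x_n] / I). *)
Section AffineVariety.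
Variables (R : realType) (n : nat) (I : ideal {mpoly R[n]}).

(* R[X] and R[X'] *)
Definition coord_ring : comPzRingType := ideal_quotient I.
Definition norm_ring : comPzRingType := normalization coord_ring.

(* R[X] -> R[X'] *)
Definition norm_map : {rmorphism coord_ring -> norm_ring} :=
  to_normalization coord_ring.

Definition real_points : set ('I_n -> R) :=
  [set v | {in I, forall p, p.@[v] = 0}].

Definition complex_points : set ('I_n -> R[i]) :=
  [set v | {in I, forall p, (map_mpoly (real_complex R) p).@[v] = 0}].

(* X(R) seen inside X(C) *)
Definition complexified_real_points : set ('I_n -> R[i]) :=
  [set w | exists2 v, real_points v & w = fun i => real_complex R (v i)].

(* A point of X'(C), as a morphism of R-algebras z : R[X'] -> C; for p in R[X'],
   the value p_C(z) is [z p]. *)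
Record norm_complex_point : Type := NormComplexPoint {
  norm_eval :> {rmorphism norm_ring -> R[i]};
  norm_eval_const : forall c : R,
    norm_eval (norm_map (quot_proj I c%:MP)) = real_complex R c
}.

(* pi'_C : X'(C) -> X(C), in the coordinates x_1, .., x_n *)
Definition norm_proj (z : norm_complex_point) : 'I_n -> R[i] :=
  fun i => z (norm_map (quot_proj I 'X_i)).

Lemma norm_projP z : complex_points (norm_proj z).
Proof.
move=> p Ip; transitivity (z (norm_map (quot_proj I p))); last first.
  have -> : quot_proj I p = 0.
    by rewrite -(rmorph0 (quot_proj I)); apply/quot_projP; rewrite subr0.
  by rewrite !rmorph0.
elim/mpolyind: p {Ip} => [|c m p _ _ IHp]; first by rewrite !rmorph0.
rewrite !rmorphD /= {}IHp; congr (_ + _).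
rewrite -mul_mpolyC !rmorphM /= norm_eval_const map_mpolyC mevalC map_mpolyX.
rewrite mevalX mpolyXE_id !rmorph_prod; congr (_ * _).
by apply: eq_bigr => i _; rewrite !rmorphXn.
Qed.

(* R[X^{R+}], as a subset of R[X'] *)
Definition Rseminormalization : set norm_ring := Rplus norm_map.

End AffineVariety.

Arguments real_points {R n} I _.
Arguments complex_points {R n} I _.
Arguments complexified_real_points {R n} I _.
Arguments Rseminormalization {R n} I _.

(* Main.v *)
Require Import Defs.
From HB Require Import structures.
From mathcomp Require Import all_boot all_order all_algebra.
From mathcomp Require Import boolp classical_sets functions filter reals complex mpoly.
From mathcomp Require Import ring zify polyrcf qe_rcf_th.
Set Implicit Arguments.
Unset Strict Implicit.
Unset Printing Implicit Defensive.
Import Order.TTheory GRing.Theory Num.Theory Pdiv.Ring Pdiv.ComRing.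
Local Open Scope ring_scope.
Local Open Scope classical_set_scope.

(** Write A for R[X], B for R[X'] and S for the polynomial ring of which A is a
    quotient; a real prime P of A is identified with its preimage in S.

    An element p of R[X^{R+}] takes equal values at two points z1, z2 of X'(C)
    above the same real point v.  The kernel P of the evaluation at v is a real
    prime, and z1, z2 extend to B_P with maximal kernels; so they kill the part
    of p that lies in Rad(B_P), and on the part that comes from A_P both are
    evaluation at v ([Rplus_fibre_constant]).

    Conversely let p be constant on the fibres over X(R) and let P be a real
    prime.  Among the polynomials with coefficients in A that vanish at p modulo
    P, after multiplication by an element outside P, choose h0 nonzero modulo P
    of least degree e.  Let v be a real point of V(P) where the leading
    coefficient s0 of h0 is not zero.  Every relation satisfied by p is, up to a
    power of s0, a multiple of h0 modulo P, hence holds at every complex root xi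
    of the specialization of h0 at v.  As B is integral over A, evaluation at v
    therefore extends to a point of X'(C) where p takes the value xi
    ([extend_complex]).  Since p has only one value above v, the specialized h0
    is s0(v) (T - q)^e, and (e s0 T + a)^e = e^e s0^(e-1) h0 at v, with a the
    coefficient of degree e - 1 of h0.  By the real Nullstellensatz such points v
    suffice to conclude that the identity holds modulo P.  Thus a power of
    e s0 p + a belongs to every prime of B over P, and p is congruent to
    - a / (e s0) modulo Rad(B_P): every maximal ideal of B_P lies over P
    ([maximal_over]).

    The weight of the proof is the real Nullstellensatz: if P is a real prime of
    S and g is not in P, some real zero of P is not a zero of g
    ([real_nullstellensatz]).  Its proof has three steps.
    - S / P embeds in an algebraically closed field ([closed_embedding]).  The
      variables are added one at a time; a transcendental one is sent to the
      class of the identity in an ultrapower of the field built so far.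
    - In that field take, by Zorn's lemma, a maximal formally real subring L
      containing S / P.  It is a real closed field.  For the intermediate value
      property, an irreducible polynomial that changes sign has a root that
      generates over L a formally real ring, hence lies in L ([ivt_contra]).
    - A finite system of polynomial equations and one inequation over R with a
      solution in L has one in R ([rcf_ex_closed]).  The coordinates of the
      solution are moved one at a time to an iterated ultrapower of R, keeping
      all signs: the number of roots of a polynomial that satisfy given sign
      conditions depends on signs of the coefficients only, by Tarski queries.
    The Hilbert basis theorem supplies the finite system. *)

Local Notation frac := Defs.frac.

(** * Ultrapowers of fields *)
Lemma fct_exprE (T : Type) (A : pzRingType) (f : T -> A) n x : (f ^+ n) x = f x ^+ n.
Proof. by elim: n => // n IH; rewrite !exprS fctE /= IH. Qed.

Section Ultrapower.
Variables (k : fieldType) (J : Type) (F : set_system J) (FU : UltraFilter F).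

(** The proof [FU] that the filter is an ultrafilter is an argument, so that
    the algebraic structures of the quotient can be attached to the type. *)
Definition null_seq of UltraFilter F : {pred J -> k} :=
  [pred f | `[< F [set j | f j = 0] >]].

Lemma null_seq_zmod : zmod_closed (null_seq FU).
Proof.
split; first by apply/asboolP; apply: filterS (filterT).
move=> f g /asboolP Ff /asboolP Fg; apply/asboolP.
by apply: filterS2 Ff Fg => j /= fj gj; rewrite !fctE fj gj subrr.
Qed.

Lemma null_seq_ideal f : {in null_seq FU, forall g, f * g \in null_seq FU}.
Proof.
move=> g /asboolP Fg; apply/asboolP; apply: filterS Fg => j /= gj.
by rewrite !fctE gj mulr0.
Qed.

HB.instance Definition _ := GRing.isZmodClosed.Build (J -> k) (null_seq FU)
  null_seq_zmod.
HB.instance Definition _ := isIdealClosed.Build (J -> k) (null_seq FU)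
  null_seq_ideal.

Definition ultrapower : Type := ideal_quotient (null_seq FU).
HB.instance Definition _ := GRing.ComPzRing.on ultrapower.
Definition ucls : {rmorphism (J -> k) -> ultrapower} := quot_proj (null_seq FU).

Lemma uclsP f g : ucls f = ucls g <-> F [set j | f j = g j].
Proof.
rewrite quot_projP; split=> [/asboolP|] Ffg; last apply/asboolP.
  by apply: filterS Ffg => j /= /subr0_eq.
by apply: filterS Ffg => j /= /eqP; rewrite -subr_eq0 => /eqP.
Qed.

Lemma ucls_surj x : exists f, x = ucls f.
Proof. by eexists; rewrite -[LHS](@quot_proj_surj _ (null_seq FU)). Qed.

Lemma ucls_eq0 f : ucls f = 0 <-> F [set j | f j = 0].
Proof. by rewrite -(rmorph0 ucls) uclsP. Qed.

Lemma ultrapower_neq0 : (1 : ultrapower) != 0.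
Proof.
apply/eqP; rewrite -(rmorph1 ucls) ucls_eq0 => /filter_ex[j E].
have /eqP : (1 : k) = 0 by exact: E.
by rewrite oner_eq0.
Qed.

HB.instance Definition _ :=
  GRing.PzSemiRing_isNonZero.Build ultrapower ultrapower_neq0.

Definition urepr (x : ultrapower) : J -> k := sval (cid (ucls_surj x)).
Lemma ureprK x : ucls (urepr x) = x.
Proof. by rewrite /urepr; case: cid => f /= ->. Qed.

Definition ultra_inv (x : ultrapower) := ucls (fun j => (urepr x j)^-1).

(** For an ultrafilter, a sequence that is not almost everywhere zero is almost
    everywhere nonzero, hence invertible. *)
Lemma ultra_mulVf x : x != 0 -> ultra_inv x * x = 1.
Proof.
move=> x0; rewrite -[X in _ * X]ureprK -rmorphM -(rmorph1 ucls); apply/uclsP.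
have [Fx|] := in_ultra_setVsetC [set j | urepr x j = 0] FU.
  by case/eqP: x0; rewrite -[x]ureprK; apply/ucls_eq0.
by apply: filterS => j /= /eqP xj; rewrite !fctE mulVf.
Qed.

Lemma ultra_inv0 : ultra_inv 0 = 0.
Proof.
apply/ucls_eq0; have /ucls_eq0 := ureprK 0.
by apply: filterS => j /= ->; rewrite invr0.
Qed.

HB.instance Definition _ :=
  GRing.ComNzRing_isField.Build ultrapower ultra_mulVf ultra_inv0.

Definition udiag (c : k) : ultrapower := ucls (fun=> c).

Lemma udiag_zmod : zmod_morphism udiag.
Proof. by move=> a b; rewrite /udiag -rmorphB. Qed.
Lemma udiag_monoid : monoid_morphism udiag.
Proof. by split=> [|a b]; rewrite /udiag -?rmorphM // -(rmorph1 ucls). Qed.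
HB.instance Definition _ := GRing.isZmodMorphism.Build k ultrapower udiag udiag_zmod.
HB.instance Definition _ := GRing.isMonoidMorphism.Build k ultrapower udiag udiag_monoid.

Lemma ultra_closed : GRing.closed_field_axiom k -> GRing.closed_field_axiom ultrapower.
Proof.
move=> cl n P n0.
have /choice[x xP] (j : J) := cl n (fun i => urepr (P i) j) n0.
exists (ucls x); rewrite -rmorphXn.
under eq_bigr => i _ do rewrite -[P i]ureprK -rmorphXn -rmorphM.
rewrite -rmorph_sum; congr (ucls _); apply/funext => j.
rewrite fct_exprE xP; elim/big_rec2: _ => // i y1 y2 _ ->.
by rewrite fctE /= fctE /= fct_exprE.
Qed.

End Ultrapower.

Section UltrapowerReal.
Variables (k : rcfType) (J : Type) (F : set_system J) (FU : UltraFilter F).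
Local Notation U := (ultrapower k FU).
Local Notation cls := (ucls k FU).

Definition ule (x y : U) : bool := `[< F [set j | urepr x j <= urepr y j] >].
Definition ult (x y : U) : bool := (y != x) && ule x y.
Definition unorm (x : U) : U := if ule 0 x then x else - x.

Lemma uleP f g : ule (cls f) (cls g) <-> F [set j | f j <= g j].
Proof.
have /uclsP fE := ureprK (cls f); have /uclsP gE := ureprK (cls g).
split=> [/asboolP|] H; last apply/asboolP.
  by apply: filterS3 fE gE H => j /= -> ->.
by apply: filterS3 fE gE H => j /= -> ->.
Qed.
Lemma ule0P f : ule 0 (cls f) <-> F [set j | 0 <= f j].
Proof. by rewrite -(rmorph0 cls) uleP. Qed.
Lemma uge0P f : ule (cls f) 0 <-> F [set j | f j <= 0].
Proof. by rewrite -(rmorph0 cls) uleP. Qed.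

Lemma ule0_add x y : ule 0 x -> ule 0 y -> ule 0 (x + y).
Proof.
rewrite -[x]ureprK -[y]ureprK -rmorphD => /ule0P Fx /ule0P Fy; apply/ule0P.
by apply: filterS2 Fx Fy => j /=; apply: addr_ge0.
Qed.
Lemma ule0_mul x y : ule 0 x -> ule 0 y -> ule 0 (x * y).
Proof.
rewrite -[x]ureprK -[y]ureprK -rmorphM => /ule0P Fx /ule0P Fy; apply/ule0P.
by apply: filterS2 Fx Fy => j /=; apply: mulr_ge0.
Qed.
Lemma ule0_anti x : ule 0 x -> ule x 0 -> x = 0.
Proof.
rewrite -[x]ureprK => /ule0P Fx /uge0P Fy; apply/ucls_eq0.
by apply: filterS2 Fx Fy => j /= h1 h2; apply/eqP; rewrite eq_le h1 h2.
Qed.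
Lemma usub_ge0 x y : ule 0 (y - x) = ule x y.
Proof.
rewrite -[x]ureprK -[y]ureprK -rmorphB; apply/idP/idP => [/ule0P|/uleP] H.
  by apply/uleP; apply: filterS H => j /=; rewrite subr_ge0.
by apply/ule0P; apply: filterS H => j /= h; rewrite !fctE /= subr_ge0.
Qed.
Lemma ule0_total x : ule 0 x || ule x 0.
Proof.
rewrite -[x]ureprK; apply/orP.
have [H|H] := in_ultra_setVsetC [set j | 0 <= urepr x j] FU.
  by left; apply/ule0P.
right; apply/uge0P; apply: filterS H => j /= /negP.
by rewrite -ltNge => /ltW.
Qed.
Lemma unormN x : unorm (- x) = unorm x.
Proof.
have E : ule 0 (- x) = ule x 0 by rewrite -[RHS]usub_ge0 sub0r.
rewrite /unorm E opprK; have := ule0_total x.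
case: ifPn => H; case: ifPn => // H' _.
by rewrite (ule0_anti H' H) oppr0.
Qed.
Lemma uge0_norm x : ule 0 x -> unorm x = x.
Proof. by rewrite /unorm => ->. Qed.

HB.instance Definition _ := Num.IntegralDomain_isLeReal.Build U
  ule0_add ule0_mul ule0_anti usub_ge0 ule0_total unormN uge0_norm (fun x y => erefl).

Lemma ucls_le f g : cls f <= cls g <-> F [set j | f j <= g j].
Proof. exact: uleP. Qed.

Lemma ucls_lt f g : cls f < cls g <-> F [set j | f j < g j].
Proof.
rewrite ltNge; split=> [/negP|] H.
  have [//|H'] := in_ultra_setVsetC [set j | f j < g j] FU.
  case: H; apply/ucls_le; apply: filterS H' => j /= /negP.
  by rewrite -leNgt.
apply/negP => /ucls_le H'; have /filter_ex[j /= []] : F ([set j | f j < g j] `&` [set j | g j <= f j]).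
  exact: filterI.
by rewrite ltNge => /negP.
Qed.

Definition upoly (p : {poly U}) (j : J) : {poly k} :=
  \poly_(i < size p) urepr p`_i j.

Lemma upoly_horner p f : p.[cls f] = cls (fun j => (upoly p j).[f j]).
Proof.
rewrite horner_coef.
under eq_bigr => i _ do rewrite -[p`_i]ureprK -rmorphXn -rmorphM.
rewrite -rmorph_sum; congr (cls _); apply/funext => j.
rewrite (horner_coef_wide _ (size_poly _ _)).
rewrite (_ : (\sum_i _) j = \sum_(i < size p) (urepr p`_i * f ^+ i) j); last first.
  by elim/big_rec2: _ => // i y1 y2 _ <-; rewrite fctE.
by apply: eq_bigr => i _; rewrite fctE /= fct_exprE coef_poly ltn_ord.
Qed.

(** The intermediate value property is inherited because roots can be chosen
    index by index. *)
Lemma ultra_rcf : Num.real_closed_axiom U.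
Proof.
move=> p a b; rewrite -[a]ureprK -[b]ureprK !upoly_horner.
set a' := urepr a; set b' := urepr b => /ucls_le ab /andP[].
rewrite -(rmorph0 cls) => /ucls_le pa /ucls_le pb.
have /choice[x xP] (j : J) : exists x, a' j <= b' j ->
    (upoly p j).[a' j] <= 0 -> 0 <= (upoly p j).[b' j] ->
    [/\ a' j <= x, x <= b' j & (upoly p j).[x] = 0].
  have [H|H] := boolP [&& a' j <= b' j, (upoly p j).[a' j] <= 0 & 0 <= (upoly p j).[b' j]].
    have /and3P[h1 h2 h3] := H.
    have [|x /andP[ax xb] /rootP rx] := poly_ivt (p := upoly p j) h1; first by rewrite h2.
    by exists x.
  by exists 0 => h1 h2 h3; rewrite h1 h2 h3 in H.
exists (cls x).
  by apply/andP; split; apply/ucls_le; apply: filterS3 ab pa pb => j h1 h2 h3;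
    have [] := xP j h1 h2 h3.
apply/rootP; rewrite upoly_horner; apply/ucls_eq0.
by apply: filterS3 ab pa pb => j h1 h2 h3; have [] := xP j h1 h2 h3.
Qed.

HB.instance Definition _ := Num.RealField_isClosed.Build U ultra_rcf.
End UltrapowerReal.

(** * Correspondences between domains *)

(** A subring of the product of two rings, written as a relation.  If its pairs
    vanish simultaneously, it is an isomorphism between a subring of the first
    ring and a subring of the second one; the relation avoids naming them. *)
Definition subring_rel (A B : comPzRingType) (G : A -> B -> Prop) :=
  [/\ G 1 1, (forall x y x' y', G x x' -> G y y' -> G (x - y) (x' - y')) &
      (forall x y x' y', G x x' -> G y y' -> G (x * y) (x' * y'))].

Section SubringRel.
Variables (A B : comPzRingType) (G : A -> B -> Prop) (sG : subring_rel G).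
Lemma subrel1 : G 1 1. Proof. by case: sG. Qed.
Lemma subrelB x y x' y' : G x x' -> G y y' -> G (x - y) (x' - y').
Proof. by case: sG => _ H _; apply: H. Qed.
Lemma subrelM x y x' y' : G x x' -> G y y' -> G (x * y) (x' * y').
Proof. by case: sG => _ _; apply. Qed.
Lemma subrel0 : G 0 0.
Proof. by have := subrelB subrel1 subrel1; rewrite !subrr. Qed.
Lemma subrelN x x' : G x x' -> G (- x) (- x').
Proof. by move/(subrelB subrel0); rewrite !sub0r. Qed.
Lemma subrelD x y x' y' : G x x' -> G y y' -> G (x + y) (x' + y').
Proof. by move=> Gx /subrelN/(subrelB Gx); rewrite !opprK. Qed.
Lemma subrel_sum (I : Type) (r : seq I) (P : pred I) (E : I -> A) (E' : I -> B) :
  (forall i, P i -> G (E i) (E' i)) ->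
  G (\sum_(i <- r | P i) E i) (\sum_(i <- r | P i) E' i).
Proof.
move=> GE; elim/big_rec2: _ => [|i y1 y2 Pi]; first exact: subrel0.
by apply: subrelD; apply: GE.
Qed.
Lemma subrel_prod (I : Type) (r : seq I) (P : pred I) (E : I -> A) (E' : I -> B) :
  (forall i, P i -> G (E i) (E' i)) ->
  G (\prod_(i <- r | P i) E i) (\prod_(i <- r | P i) E' i).
Proof.
move=> GE; elim/big_rec2: _ => [|i y1 y2 Pi]; first exact: subrel1.
by apply: subrelM; apply: GE.
Qed.
Lemma subrelX x x' n : G x x' -> G (x ^+ n) (x' ^+ n).
Proof.
move=> Gx; elim: n => [|n IH]; first exact: subrel1.
by rewrite !exprS; apply: subrelM.
Qed.
Lemma subrelMn x x' n : G x x' -> G (x *+ n) (x' *+ n).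
Proof.
move=> Gx; elim: n => [|n IH]; first exact: subrel0.
by rewrite !mulrS; apply: subrelD.
Qed.
End SubringRel.

Section PolyRel.
Variables (K1 K2 : idomainType) (G : K1 -> K2 -> Prop).
Hypothesis sG : subring_rel G.

Definition poly_rel (p : {poly K1}) (q : {poly K2}) := forall i, G p`_i q`_i.

Lemma poly_relC x x' : G x x' -> poly_rel x%:P x'%:P.
Proof. by move=> Gx i; rewrite !coefC; case: eqP => _ //; exact: (subrel0 sG). Qed.

Lemma poly_relXn n : poly_rel 'X^n 'X^n.
Proof. by move=> i; rewrite !coefXn; exact/(subrelMn sG)/(subrel1 sG). Qed.

Lemma poly_rel_subring : subring_rel poly_rel.
Proof.
split; first exact/poly_relC/(subrel1 sG).
  by move=> p q p' q' Gp Gq i; rewrite !coefB; exact: (subrelB sG).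
by move=> p q p' q' Gp Gq i; rewrite !coefM; apply: (subrel_sum sG) => // j _; exact: (subrelM sG).
Qed.

Lemma poly_relZ x x' p p' : G x x' -> poly_rel p p' -> poly_rel (x *: p) (x' *: p').
Proof. by move=> Gx Gp; rewrite -!mul_polyC; apply: (subrelM poly_rel_subring) => //; apply: poly_relC. Qed.

Lemma poly_rel_deriv p p' : poly_rel p p' -> poly_rel p^`() p'^`().
Proof. by move=> Gp i; rewrite !coef_deriv; apply: (subrelMn sG). Qed.

(** The subring generated by [G] and [(x, w)], after [phi] has enlarged the
    second ring to contain [w]. *)
Definition adjoin_rel (K3 : idomainType) (phi : K2 -> K3) (x : K1) (w : K3)
    (u : K1) (v : K3) :=
  exists p q, [/\ poly_rel p q, u = p.[x] & v = (map_poly phi q).[w]].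

Lemma adjoin_subring (K3 : idomainType) (phi : {rmorphism K2 -> K3}) x w :
  subring_rel (adjoin_rel phi x w).
Proof.
have sP := poly_rel_subring; split.
- by exists 1, 1; split; rewrite ?rmorph1 ?hornerC //; exact: (subrel1 sP).
- move=> _ _ _ _ [p [q [pq -> ->]]] [p1 [q1 [pq1 -> ->]]].
  exists (p - p1), (q - q1); split; rewrite ?rmorphB ?hornerE //.
  exact: (subrelB sP).
- move=> _ _ _ _ [p [q [pq -> ->]]] [p1 [q1 [pq1 -> ->]]].
  exists (p * p1), (q * q1); split; rewrite ?rmorphM ?hornerE //.
  exact: (subrelM sP).
Qed.

Lemma adjoin_sub (K3 : idomainType) (phi : {rmorphism K2 -> K3}) x w u v :
  G u v -> adjoin_rel phi x w u (phi v).
Proof.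
move=> Guv; exists u%:P, v%:P; rewrite map_polyC !hornerC.
by split => //; apply: poly_relC.
Qed.

Lemma adjoin_gen (K3 : idomainType) (phi : {rmorphism K2 -> K3}) x w :
  adjoin_rel phi x w x w.
Proof.
exists 'X, 'X; rewrite map_polyX !hornerX; split => //.
by have := @poly_relXn 1; rewrite !expr1.
Qed.

Hypothesis zG : forall x y, G x y -> (x == 0) = (y == 0).

Lemma poly_rel_size p p' : poly_rel p p' -> size p = size p'.
Proof.
move=> Gp; apply/eqP; rewrite eqn_leq.
by apply/andP; split; apply/leq_sizeP => j hj; apply/eqP;
  [rewrite (zG (Gp j))|rewrite -(zG (Gp j))]; rewrite nth_default.
Qed.

Lemma poly_rel_eq0 p p' : poly_rel p p' -> (p == 0) = (p' == 0).
Proof. by move=> Gp; rewrite -!size_poly_eq0 (poly_rel_size Gp). Qed.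

Lemma poly_rel_lead p p' : poly_rel p p' -> G (lead_coef p) (lead_coef p').
Proof. by move=> Gp; rewrite /lead_coef (poly_rel_size Gp). Qed.

(** Pseudo-division only tests sizes, so it performs the same steps on
    corresponding polynomials. *)
Lemma poly_rel_redivp p p' q q' : poly_rel p p' -> poly_rel q q' ->
  [/\ rscalp p q = rscalp p' q', poly_rel (rdivp p q) (rdivp p' q')
    & poly_rel (rmodp p q) (rmodp p' q')].
Proof.
move=> Gp Gq; have sP := poly_rel_subring.
have Glq := poly_rel_lead Gq; have p0 : poly_rel 0 0 := subrel0 sP.
rewrite /rscalp /rdivp /rmodp !unlock (poly_rel_eq0 Gq) (poly_rel_size Gp).
case: ifP => // _; rewrite /redivp_rec (poly_rel_size Gq).
set lq := lead_coef q in Glq *; set lq' := lead_coef q' in Glq *.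
move: (size p') => n; elim: n 0%N (0 : {poly K1}) (0 : {poly K2}) p p' Gp p0 => [|n IH] k a a' p p' Gp Ga /=;
  rewrite (poly_rel_size Gp); case: ifP => // _.
  split=> //.
    apply: (subrelD sP); first by apply: (subrelM sP) => //; apply: poly_relC.
    by apply: poly_relZ; [apply: poly_rel_lead|apply: poly_relXn].
  apply: (subrelB sP); first by apply: (subrelM sP) => //; apply: poly_relC.
  by apply: (subrelM sP) => //; apply: poly_relZ; [apply: poly_rel_lead|apply: poly_relXn].
apply: IH.
  apply: (subrelB sP); first by apply: (subrelM sP) => //; apply: poly_relC.
  by apply: (subrelM sP) => //; apply: poly_relZ; [apply: poly_rel_lead|apply: poly_relXn].
apply: (subrelD sP); first by apply: (subrelM sP) => //; apply: poly_relC.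
by apply: poly_relZ; [apply: poly_rel_lead|apply: poly_relXn].
Qed.
End PolyRel.

Fixpoint seq_rel (A B : Type) (R : A -> B -> Prop) s t : Prop :=
  match s, t with
  | [::], [::] => True
  | x :: s', y :: t' => R x y /\ seq_rel R s' t'
  | _, _ => False
  end.

Lemma seq_rel_size A B (R : A -> B -> Prop) s t : seq_rel R s t -> size s = size t.
Proof. by elim: s t => [|x s IH] [|y t] //= [_ /IH ->]. Qed.
Lemma seq_rel_nth A B (R : A -> B -> Prop) x0 y0 s t i :
  R x0 y0 -> seq_rel R s t -> R (nth x0 s i) (nth y0 t i).
Proof. by move=> R0; elim: s t i => [|x s IH] [|y t] [|i] //= [] // _; apply: IH. Qed.
Lemma seq_rel_map A B A' B' (R : A -> B -> Prop) (R' : A' -> B' -> Prop) f g s t :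
  (forall x y, R x y -> R' (f x) (g y)) -> seq_rel R s t -> seq_rel R' (map f s) (map g t).
Proof. by move=> RR; elim: s t => [|x s IH] [|y t] //= [/RR ? /IH]. Qed.
(** The coefficients that turn Tarski queries into root counts are rational
    numbers, the same ones in all real closed fields. *)
Lemma ratr_coefs (K : rcfType) n i : coefs K n i = ratr (coefs rat n i).
Proof.
rewrite /coefs.
set e1 := (X in X`_i); set e2 := (X in ratr X`_i).
have -> : e1 = map ratr e2.
  rewrite /e1 /e2 -[RHS]map_comp; apply: eq_map => j /=.
  rewrite !castmxE.
  have -> : map_mx (intmul 1) (ctmat n) = map_mx (@ratr K) (map_mx (intmul (1:rat)) (ctmat n)).
    by apply/matrixP => a b; rewrite !mxE rmorph_int.
  by rewrite -map_invmx [LHS]mxE.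
elim: {e1} e2 i => [|x s IH] [|i] //=; rewrite ?nth_nil ?rmorph0 //.
Qed.

(** * Transfer of sign conditions between real closed fields *)
Section SignRel.
Variables (K1 K2 : rcfType) (G : K1 -> K2 -> Prop).
Hypothesis sG : subring_rel G.
Hypothesis sgG : forall x y, G x y -> sgz x = sgz y.

Let zG x y : G x y -> (x == 0) = (y == 0).
Proof. by move=> /sgG E; rewrite -[LHS]sgz_eq0 -[RHS]sgz_eq0 E. Qed.
Let gt0G x y : G x y -> (0 < x) = (0 < y).
Proof. by move=> /sgG E; rewrite -[LHS]sgz_gt0 -[RHS]sgz_gt0 E. Qed.
Let lt0G x y : G x y -> (x < 0) = (y < 0).
Proof. by move=> /sgG E; rewrite -[LHS]sgz_lt0 -[RHS]sgz_lt0 E. Qed.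
Local Notation pc := (poly_rel G).
Let sP := poly_rel_subring sG.

Lemma changes_rel s t : seq_rel G s t -> changes s = changes t.
Proof.
elim: s t => [|x s IH] [|y t] //= [Gxy Gst]; rewrite (IH _ Gst).
congr (nat_of_bool _ + _)%N; apply/lt0G/(subrelM sG) => //.
by case: s t Gst {IH} => [|? ?] [|? ?] //=; [move=> _; exact: (subrel0 sG)|case].
Qed.

Lemma next_mod_rel p p' q q' : pc p p' -> pc q q' ->
  pc (next_mod p q) (next_mod p' q').
Proof.
move=> Gp Gq; have [e1 _ e2] := poly_rel_redivp sG zG Gp Gq.
rewrite /next_mod e1; apply: poly_relZ => //.
by apply: (subrelN sG); apply: (subrelX sG); apply: poly_rel_lead.
Qed.

Lemma mods_rel p p' q q' : pc p p' -> pc q q' -> seq_rel pc (mods p q) (mods p' q').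
Proof.
elim: mods {-2}p {-2}q (erefl (mods p q)) p' q' => [|r s IH] {}p {}q E p' q' Gp Gq.
  move/eqP: E; rewrite mods_eq0 => p0; move: (p0).
  by rewrite (poly_rel_eq0 zG Gp) => /eqP ->; rewrite (eqP p0) !mods0p.
move: E; rewrite [mods p q]mods_rec [mods p' q']mods_rec -(poly_rel_eq0 zG Gp).
case: ifP => // _ [_ E].
by split=> //; apply: IH => //; apply: next_mod_rel.
Qed.

Lemma taqR_rel p p' q q' : pc p p' -> pc q q' -> taqR p q = taqR p' q'.
Proof.
move=> Gp Gq; have Gm : seq_rel pc (mods p (p^`() * q)) (mods p' (p'^`() * q')).
  by apply: mods_rel => //; apply: (subrelM sP) => //; apply: poly_rel_deriv.
rewrite /taqR /changes_mods /changes_poly /changes_minfty /changes_pinfty.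
congr (_%:Z - _%:Z); apply: changes_rel; apply: seq_rel_map Gm => u v Guv.
  rewrite (poly_rel_size zG Guv); apply: (subrelM sG); last exact: poly_rel_lead.
  exact/(subrelX sG)/(subrelN sG)/(subrel1 sG).
exact: poly_rel_lead.
Qed.

Lemma poly_comb_rel sq sq' sc : seq_rel pc sq sq' -> pc (poly_comb sq sc) (poly_comb sq' sc).
Proof.
move=> Gs; rewrite /poly_comb (seq_rel_size Gs); apply: (subrel_prod sP) => // i _.
by apply: (subrelX sP); apply: (seq_rel_nth _ _ Gs); exact: (subrel0 sP).
Qed.

(** The count is a rational combination of Tarski queries, and those are
    differences of numbers of sign changes in signed remainder sequences. *)
Lemma ccount_weak_rel p p' sq sq' : pc p p' -> seq_rel pc sq sq' ->
  (0 < ccount_weak p sq) = (0 < ccount_weak p' sq').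
Proof.
move=> Gp Gs; rewrite /ccount_weak -(seq_rel_size Gs).
have taqs i : exists t : int, taqsR p sq i = ratr t%:~R /\ taqsR p' sq' i = ratr t%:~R.
  exists (taqR p (map (poly_comb sq) (sg_tab (size sq)))`_i).
  rewrite /taqsR !rmorph_int; split=> //; congr (_%:~R); apply/esym/taqR_rel => //.
  rewrite -(seq_rel_size Gs).
  have [h|h] := ltnP i (size (sg_tab (size sq))).
    by rewrite !(nth_map [::]) //; apply: poly_comb_rel.
  by rewrite !nth_default ?size_map //; exact: (subrel0 sP).
set a1 := (X in (0 < X 0 _) = _); set a2 := (X in _ = (0 < X 0 _)).
set n := (3 ^ _)%N.
suff [r [-> ->]] : exists r, a1 0 n = ratr r /\ a2 0 n = ratr r by rewrite !ltr0q.
have: (0 : K1) = ratr 0 /\ (0 : K2) = ratr 0 by rewrite !rmorph0.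
move: (0 : K1) (0 : K2) (0 : rat) => u1 u2 r.
elim: n u1 u2 r => [|n IH] u1 u2 r [-> ->] /=; first by exists r.
have [t [-> ->]] := taqs n; rewrite !ratr_coefs.
by apply: (IH _ _ (t%:~R * coefs rat (size sq) n + r)); rewrite !rmorphD !rmorphM.
Qed.

Lemma bounding_poly_rel sq sq' : seq_rel pc sq sq' ->
  pc (bounding_poly sq) (bounding_poly sq').
Proof.
move=> Gs; apply: poly_rel_deriv => //.
elim: sq sq' Gs => [|q sq IH] [|q' sq'] //=; first by rewrite !big_nil => _; exact: (subrel1 sP).
by rewrite !big_cons => -[Gq /IH]; exact: (subrelM sP).
Qed.

Lemma rgcdp_rel p p' q q' : pc p p' -> pc q q' -> pc (rgcdp p q) (rgcdp p' q').
Proof.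
move=> Gp Gq; rewrite /rgcdp (poly_rel_size zG Gp) (poly_rel_size zG Gq).
have loop_rel p1 p1' q1 q1' : pc p1 p1' -> pc q1 q1' ->
  pc (if p1 == 0 then q1 else
  let fix loop (n : nat) (pp qq : {poly K1}) {struct n} :=
      let rr := rmodp pp qq in
      if rr == 0 then qq else
      if n is n1.+1 then loop n1 qq rr else rr in
  loop (size p1) p1 q1) (if p1' == 0 then q1' else
  let fix loop (n : nat) (pp qq : {poly K2}) {struct n} :=
      let rr := rmodp pp qq in
      if rr == 0 then qq else
      if n is n1.+1 then loop n1 qq rr else rr in
  loop (size p1') p1' q1').
  move=> Gp1 Gq1; rewrite (poly_rel_eq0 zG Gp1) (poly_rel_size zG Gp1); case: ifP => // _.
  move: (size p1') => n; elim: n p1 p1' q1 q1' Gp1 Gq1 => [|n IH] p1 p1' q1 q1' Gp1 Gq1 /=;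
    have [_ _ Gr] := poly_rel_redivp sG zG Gp1 Gq1;
    rewrite (poly_rel_eq0 zG Gr); case: ifP => // _.
  exact: IH.
by case: ifP => _; apply: loop_rel.
Qed.

Lemma ccount_gt0_rel sp sp' sq sq' : seq_rel pc sp sp' -> seq_rel pc sq sq' ->
  ccount_gt0 sp sq = ccount_gt0 sp' sq'.
Proof.
move=> Gp Gs; rewrite /ccount_gt0.
set p := \big[_/_]_(_ <- sp) _; set p' := \big[_/_]_(_ <- sp') _.
have Gpp : pc p p'.
  rewrite /p /p'; elim: sp sp' Gp {p p'} => [|u sp IH] [|u' sp'] //=.
    by rewrite !big_nil => _; exact: (subrel0 sP).
  by rewrite !big_cons => -[Gu /IH]; apply: rgcdp_rel.
rewrite (poly_rel_eq0 zG Gpp); case: ifP => _; first exact: ccount_weak_rel.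
have Gb := bounding_poly_rel Gs; rewrite (ccount_weak_rel Gb Gs).
congr [|| _, _ | _].
  elim: sq sq' Gs {Gb} => [|u sq IH] [|u' sq'] //=; first by rewrite !big_nil.
  rewrite !big_cons => -[Gu /IH ->]; congr (_ && _).
  exact/gt0G/(poly_rel_lead zG).
elim: sq sq' Gs {Gb} => [|u sq IH] [|u' sq'] //=; first by rewrite !big_nil.
rewrite !big_cons => -[Gu /IH ->]; congr (_ && _); apply: gt0G.
rewrite (poly_rel_size zG Gu); apply: (subrelM sG); last exact: (poly_rel_lead zG).
exact/(subrelX sG)/(subrelN sG)/(subrel1 sG).
Qed.

(** Whether finitely many sign conditions have a common solution is decided by
    [ccount_gt0] from signs of expressions in the coefficients.  This is the
    one-variable case of Tarski's transfer principle. *)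
Lemma sign_transfer (x : K1) (us : seq ({poly K1} * {poly K2})) :
  {in us, forall u, pc u.1 u.2} ->
  exists w, {in us, forall u, sgz u.1.[x] = sgz u.2.[w]}.
Proof.
move=> Gus; pose s (u : {poly K1} * {poly K2}) := sgz u.1.[x].
pose us0 := [seq u <- us | s u == 0]; pose us1 := [seq u <- us | s u != 0].
(* multiplying by the sign turns every strict condition into positivity *)
pose f1 u : {poly K1} := (s u)%:~R *: u.1.
pose f2 u : {poly K2} := (s u)%:~R *: u.2.
have relmap (T : eqType) (ts : seq T) (g1 : T -> {poly K1}) (g2 : T -> {poly K2}) :
    {in ts, forall u, pc (g1 u) (g2 u)} -> seq_rel pc (map g1 ts) (map g2 ts).
  elim: ts => //= u ts IH H; split; first by apply: H; rewrite mem_head.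
  by apply: IH => v tv; apply: H; rewrite in_cons tv orbT.
have Gint (m : int) : G m%:~R m%:~R.
  case: m => m; rewrite ?NegzE ?mulrNz; first exact/(subrelMn sG)/(subrel1 sG).
  exact/(subrelN sG)/(subrelMn sG)/(subrel1 sG).
have: ccount_gt0 (map fst us0) (map f1 us1).
  apply/ccount_gt0P; exists x; rewrite !big_map !big_all; apply/andP; split.
    by apply/allP => u; rewrite mem_filter sgz_eq0 => /andP[].
  apply/allP => u; rewrite mem_filter => /andP[su _].
  by rewrite hornerZ -sgz_gt0 sgzM sgz_int /s sgz_id -sgzM -expr2 sgz_gt0 exprn_even_gt0 //= -sgz_eq0.
rewrite (@ccount_gt0_rel _ (map snd us0) _ (map f2 us1)); first last.
- by apply: relmap => u; rewrite mem_filter => /andP[_ /Gus]; apply: poly_relZ.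
- by apply: relmap => u; rewrite mem_filter => /andP[_ /Gus].
case/ccount_gt0P => w; rewrite !big_map !big_all => /andP[/allP H0 /allP H1].
exists w => u uus; have [su|su] := eqVneq (s u) 0.
  have /H0/eqP -> : u \in us0 by rewrite mem_filter su eqxx.
  by rewrite -/(s u) su sgz0.
have /H1 : u \in us1 by rewrite mem_filter su.
rewrite hornerZ -sgz_gt0 sgzM sgz_int /s sgz_id.
by move: su; rewrite /s; do 2 case: sgzP.
Qed.
End SignRel.

(** * Existential closedness of a real closed field in its extensions *)

(** Compactness: the role of the finite intersection property is to make any
    family of conditions that is finitely satisfiable in [k] satisfiable in one
    ultrapower of [k], by the class of the identity. *)
Lemma ultrafilter_of_fip (I : eqType) (J : Type) (D : set I) (A : I -> set J) :
  (forall s : seq I, {in s, forall i, D i} -> exists j, {in s, forall i, A i j}) ->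
  exists2 F : set_system J, UltraFilter F & forall i, D i -> F (A i).
Proof.
move=> fip.
pose F0 : set_system J := fun B => exists2 s : seq I, {in s, forall i, D i} &
   forall j, {in s, forall i, A i j} -> B j.
have FF : Filter F0.
  split; first by exists [::].
    move=> P Q [s sD sP] [t tD tQ]; exists (s ++ t).
      by move=> i; rewrite mem_cat => /orP[/sD|/tD].
    move=> j H; split; first by apply: sP => i si; apply: H; rewrite mem_cat si.
    by apply: tQ => i ti; apply: H; rewrite mem_cat ti orbT.
  by move=> P Q PQ [s sD sP]; exists s => // j /sP /PQ.
have PF : ProperFilter F0.
  split=> // -[s sD sP]; have [j /sP] := fip s sD; exact.
have [F [UF sF]] := ultraFilterLemma PF.
exists F => // i Di; apply: sF; exists [:: i] => [k|j H].
  by rewrite inE => /eqP ->.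
by apply: H; rewrite mem_head.
Qed.

Section MpolyInd.
Variables (K : comNzRingType) (n : nat).
Lemma mpoly_ring_ind (P : {mpoly K[n]} -> Prop) :
  (forall c, P c%:MP) -> (forall i, P 'X_i) ->
  (forall p q, P p -> P q -> P (p + q)) ->
  (forall p q, P p -> P q -> P (p * q)) -> forall p, P p.
Proof.
move=> PC PX PD PM; elim/mpolyind => [|c m p _ _ IHp]; first by rewrite -mpolyC0.
apply: PD => //; rewrite -mul_mpolyC; apply: (PM); first exact: PC.
rewrite mpolyXE_id; apply: big_ind => [||i _]; [exact: (PC 1)|exact: (PM)|].
by elim: (m i) => [|d IH]; rewrite ?expr0 -?mpolyC1 // exprS; apply: (PM).
Qed.
End MpolyInd.

(** A morphism of real closed fields is increasing, since the nonnegative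
    elements are the squares. *)
Lemma rcf_sgz (K L : rcfType) (f : {rmorphism K -> L}) x : sgz (f x) = sgz x.
Proof.
have pos (y : K) : 0 <= y -> 0 <= f y.
  by move=> y0; rewrite -(sqr_sqrtr y0) rmorphXn sqr_ge0.
have [->|x0] := eqVneq x 0; first by rewrite rmorph0 !sgz0.
have fx0 : f x != 0 by rewrite fmorph_eq0.
have [xp|xn] := leP 0 x.
  by rewrite !gtr0_sgz // lt_neqAle eq_sym ?fx0 ?x0 ?pos.
have := pos (- x); rewrite oppr_ge0 ltW // rmorphN oppr_ge0 => /(_ isT) fn.
by rewrite !ltr0_sgz // lt_neqAle fx0.
Qed.

Section UltraPoint.
Variables (k : rcfType) (J : Type) (F : set_system J) (FU : UltraFilter F).

Lemma ucls_sgz (s : int) f : F [set j | sgz (f j) = s] -> sgz (ucls k FU f) = s.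
Proof.
move=> Fs; case: sgzP => h.
- have /filter_ex[j /= [E /= <-]] : F ([set j | f j = 0] `&` [set j | sgz (f j) = s]).
    by apply: filterI => //; apply/ucls_eq0.
  by rewrite E sgz0.
- move: h; rewrite -(rmorph0 (ucls k FU)) => /ucls_lt h.
  have /filter_ex[j /= [E /= <-]] : F ([set j | 0 < f j] `&` [set j | sgz (f j) = s]).
    exact: filterI.
  by rewrite gtr0_sgz.
- move: h; rewrite -(rmorph0 (ucls k FU)) => /ucls_lt h.
  have /filter_ex[j /= [E /= <-]] : F ([set j | f j < 0] `&` [set j | sgz (f j) = s]).
    exact: filterI.
  by rewrite ltr0_sgz.
Qed.
End UltraPoint.

Lemma ucls_horner (k : fieldType) (J : Type) (F : set_system J) (FU : UltraFilter F)
   (p : {poly k}) (f : J -> k) :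
  (map_poly (udiag (k:=k) FU) p).[ucls k FU f] = ucls k FU (fun j => p.[f j]).
Proof.
elim/poly_ind: p => [|p c IH].
  rewrite rmorph0 horner0 -(rmorph0 (ucls k FU)); congr (ucls _ _ _).
  by apply/funext => j; rewrite horner0.
rewrite rmorphD rmorphM /= map_polyX map_polyC !hornerE IH.
rewrite /udiag -rmorphM -rmorphD; congr (ucls _ _ _).
by apply/funext => j; rewrite !hornerE.
Qed.

Section SignStep.
Variables (L k : rcfType) (G : L -> k -> Prop).
Hypothesis (sG : subring_rel G) (sgG : forall x y, G x y -> sgz x = sgz y).

(** Extension of a sign-preserving correspondence to one more element [x]: by
    [sign_transfer] every finite part of the sign pattern of [x] is realized in
    [k], hence all of it in an ultrapower. *)
Lemma sign_step (x : L) : exists (J : Type) (F : set_system J) (FU : UltraFilter F)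
   (w : ultrapower k FU), forall u v, adjoin_rel G (udiag (k:=k) FU) x w u v -> sgz u = sgz v.
Proof.
have [|F FU HF] := @ultrafilter_of_fip _ k [set u : {poly L} * {poly k} | poly_rel G u.1 u.2]
   (fun u => [set w | sgz u.1.[x] = sgz u.2.[w]]).
  by move=> s Gs; have [w] := sign_transfer sG sgG x Gs; exists w.
exists k, F, FU, (ucls k FU id) => _ _ [p [q [pq -> ->]]].
rewrite ucls_horner; apply/esym/ucls_sgz.
by apply: filterS (HF (p, q) pq) => w /= ->.
Qed.
End SignStep.

Lemma mpoly_eval_pointwise (R k U : comNzRingType) (J : Type) (n : nat)
    (rho : {rmorphism R -> k}) (phi : {rmorphism R -> U})
    (cls : {rmorphism (J -> k) -> U}) (w : 'I_n -> U) (f : 'I_n -> J -> k) p :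
  (forall c, phi c = cls (fun=> rho c)) -> (forall i, w i = cls (f i)) ->
  (map_mpoly phi p).@[w] = cls (fun j => (map_mpoly rho p).@[fun i => f i j]).
Proof.
move=> Hphi Hw; elim/mpoly_ring_ind: p => [c|i|p q IHp IHq|p q IHp IHq].
- transitivity (phi c); first by rewrite map_mpolyC mevalC.
  rewrite Hphi; congr (cls _); apply/funext => j.
  by rewrite map_mpolyC mevalC.
- rewrite map_mpolyX mevalXU Hw; congr (cls _); apply/funext => j.
  by rewrite map_mpolyX mevalXU.
- rewrite !rmorphD /= IHp IHq -rmorphD; congr (cls _); apply/funext => j.
  by rewrite !rmorphD.
- rewrite !rmorphM /= IHp IHq -rmorphM; congr (cls _); apply/funext => j.
  by rewrite !rmorphM.
Qed.

Section ExClosed.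
Variables (R : rcfType) (n : nat).

(** Existential closedness of [R] in [k]; a single inequation [g] suffices in a
    field, as several can be multiplied together. *)
Definition ex_closed (k : rcfType) (rho : {rmorphism R -> k}) :=
  forall (ps : seq {mpoly R[n]}) (g : {mpoly R[n]}) (w : 'I_n -> k),
    {in ps, forall p, (map_mpoly rho p).@[w] = 0} -> (map_mpoly rho g).@[w] != 0 ->
    exists2 v : 'I_n -> R, {in ps, forall p, p.@[v] = 0} & g.@[v] != 0.

Lemma ex_closed_ultra (k : rcfType) (rho : {rmorphism R -> k})
    (J : Type) (F : set_system J) (FU : UltraFilter F) :
  ex_closed rho -> ex_closed (udiag (k:=k) FU \o rho).
Proof.
move=> ex ps g w; pose f i := urepr (w i).
have E p : (map_mpoly (udiag (k:=k) FU \o rho) p).@[w] =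
   ucls k FU (fun j => (map_mpoly rho p).@[fun i => f i j]).
  by apply: mpoly_eval_pointwise => // i; rewrite /f ureprK.
move=> ps0 g0.
have Fps : F [set j | {in ps, forall p, (map_mpoly rho p).@[fun i => f i j] = 0}].
  elim: ps ps0 => [|p ps IH] ps0; first exact: filterS filterT.
  have /IH H : {in ps, forall p, (map_mpoly (udiag (k:=k) FU \o rho) p).@[w] = 0}.
    by move=> q qps; apply: ps0; rewrite inE qps orbT.
  have := ps0 p; rewrite mem_head E => /(_ isT) /ucls_eq0 Hp.
  by apply: filterS2 H Hp => j /= h1 h2 q; rewrite inE => /predU1P[->|/h1].
have [/ucls_eq0|Fg] := in_ultra_setVsetC
    [set j | (map_mpoly rho g).@[fun i => f i j] = 0] FU.
  by rewrite -E => /eqP; rewrite (negPf g0).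
have [j [h1 /eqP h2]] := filter_ex (filterI Fps Fg).
exact: ex h1 h2.
Qed.

Lemma ex_closed_id : ex_closed (idfun : {rmorphism R -> R}).
Proof.
have E p (w : 'I_n -> R) : (map_mpoly (idfun : {rmorphism R -> R}) p).@[w] = p.@[w].
  elim/mpoly_ring_ind: p => [c|i|p q IHp IHq|p q IHp IHq].
  - by rewrite map_mpolyC.
  - by rewrite map_mpolyX.
  - by rewrite !rmorphD /= IHp IHq.
  - by rewrite !rmorphM /= IHp IHq.
by move=> ps g w H gw; exists w => [p /H|]; [|move: gw]; rewrite E.
Qed.

(** The coordinates of a solution in [L] are transported one by one to iterated
    ultrapowers of [R], for which the claim holds by evaluation at some index. *)
Theorem rcf_ex_closed (L : rcfType) (iota : {rmorphism R -> L}) : ex_closed iota.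
Proof.
move=> ps g t pst gt.
have [k [rho [G [sG sgG Grho [ex]]]]] : exists (k : rcfType) (rho : {rmorphism R -> k})
    (G : L -> k -> Prop), [/\ subring_rel G, forall x y, G x y -> sgz x = sgz y,
      forall c, G (iota c) (rho c) & ex_closed rho /\
      {in enum 'I_n, forall i, exists w, G (t i) w}].
  elim: (enum 'I_n) => [|i s [k [rho [G [sG sgG Grho [ex wP]]]]]].
    exists R, idfun, (fun x y => x = iota y); split.
    - by split=> [|x y x' y' -> ->|x y x' y' -> ->]; rewrite ?rmorph1 ?rmorphB ?rmorphM.
    - by move=> x y ->; rewrite rcf_sgz.
    - by [].
    - by split=> //; apply: ex_closed_id.
  have [J [F [FU [w sgw]]]] := sign_step sG sgG (t i).
  exists (ultrapower k FU), (udiag (k:=k) FU \o rho), (adjoin_rel G (udiag (k:=k) FU) (t i) w).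
  split=> //; first exact: adjoin_subring.
    by move=> c; apply: adjoin_sub.
  split; first exact: ex_closed_ultra.
  move=> j; rewrite inE => /predU1P[->|/wP[w' Gw]]; first by exists w; apply: adjoin_gen.
  by exists (udiag (k:=k) FU w'); apply: adjoin_sub.
move=> wP; have /choice[w {}wP] i : exists w, G (t i) w by apply: wP; rewrite mem_enum.
have Gp p : G (map_mpoly iota p).@[t] (map_mpoly rho p).@[w].
  elim/mpoly_ring_ind: p => [c|i|p q IHp IHq|p q IHp IHq].
  - by rewrite !map_mpolyC !mevalC; exact: Grho.
  - rewrite !map_mpolyX !mevalXU; exact: wP.
  - by rewrite !(rmorphD (map_mpoly _)) !mevalD; apply: (subrelD sG).
  - by rewrite !(rmorphM (map_mpoly _)) !mevalM; apply: (subrelM sG).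
apply: (ex ps g w) => [p /pst p0|].
  by apply/eqP; rewrite -sgz_eq0 -(sgG _ _ (Gp p)) p0 sgz0.
by rewrite -sgz_eq0 -(sgG _ _ (Gp g)) sgz_eq0.
Qed.
End ExClosed.

(** * Embedding a domain in an algebraically closed field *)
Lemma closed_root (F : fieldType) (p : {poly F}) :
  GRing.closed_field_axiom F -> size p != 1%N -> exists x, root p x.
Proof.
move=> cl; have [->|p0] := eqVneq p 0; first by exists 0; rewrite root0.
have lp0 : lead_coef p != 0 by rewrite lead_coef_eq0.
case Ep: (size p) => [|[|n]] // _.
  by move/eqP: Ep; rewrite size_poly_eq0 (negPf p0).
have [x xP] := cl n.+1 (fun i => - (p`_i / lead_coef p)) isT.
exists x; rewrite /root horner_coef Ep big_ord_recr /= xP.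
rewrite lead_coefE Ep /= mulr_sumr -big_split /=.
apply/eqP; rewrite big1 // => i _; rewrite lead_coefE Ep /= in lp0.
by rewrite mulNr mulrN mulrA mulrCA divff // mulr1 subrr.
Qed.

Lemma poly_infinite (F : idomainType) (p : {poly F}) :
  (forall m, exists s : seq F, uniq s /\ size s = m) -> p != 0 -> exists x, p.[x] != 0.
Proof.
move=> inf p0; have [s [us ss]] := inf (size p).
case: (boolP (all (root p) s)) => [rs|/allPn[x _ px]]; last by exists x.
by have := max_poly_roots p0 rs us; rewrite ss ltnn.
Qed.

Section ZeroStep.
Variables (K : idomainType) (Om : fieldType) (G : K -> Om -> Prop).
Hypothesis (cl : GRing.closed_field_axiom Om).
Hypothesis (sG : subring_rel G) (zG : forall x y, G x y -> (x == 0) = (y == 0)).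
Hypothesis (inf : forall m, exists s : seq Om, uniq s /\ size s = m).
Local Notation pc := (poly_rel G).
Let sP := poly_rel_subring sG.

Let pdiv p p' q q' : pc p p' -> pc q q' -> q != 0 -> exists (k : nat) a a' r r',
  [/\ pc a a', pc r r', (size r < size q)%N,
      lead_coef q ^+ k *: p = a * q + r & lead_coef q' ^+ k *: p' = a' * q' + r'].
Proof.
move=> Gp Gq q0; have [e1 e2 e3] := poly_rel_redivp sG zG Gp Gq.
exists (rscalp p q), (rdivp p q), (rdivp p' q'), (rmodp p q), (rmodp p' q').
by split=> //; rewrite ?ltn_rmodpN0 ?rdivp_eq // e1 rdivp_eq.
Qed.

(** If [x] satisfies a nontrivial relation, take one, [f], of least degree, and
    for [w] a root of the corresponding polynomial [f'].  Division by [f] shows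
    that the relations of [x] hold for [w].  For the converse, let [g] have least
    degree among the relations of [w]; then [f] is a multiple [q * g] up to a
    constant, and [q] cannot vanish at [x] for reasons of degree, so [g] does.  *)
Let algebraic_case (x : K) f f' : pc f f' -> f != 0 -> f.[x] = 0 ->
  exists w, forall h h', pc h h' -> (h.[x] == 0) = (h'.[w] == 0).
Proof.
move=> Gf f0 fx.
have exm : exists m, `[< exists g g', [/\ pc g g', g != 0, g.[x] = 0 & size g = m] >].
  by exists (size f); apply/asboolP; exists f, f'.
case: (ex_minnP exm) => m /asboolP[{}f [{}f' [{}Gf {}f0 {}fx fm]]] minf {exm}.
have {}minf g g' : pc g g' -> g.[x] = 0 -> (size g < size f)%N -> g = 0.
  move=> Gg gx sg; apply/eqP/negPn/negP => g0.
  have /minf : `[< exists g0 g0', [/\ pc g0 g0', g0 != 0, g0.[x] = 0 & size g0 = size g] >].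
    by apply/asboolP; exists g, g'.
  by rewrite -fm leqNgt sg.
have [|w /rootP fw] := closed_root (p := f') cl.
  rewrite -(poly_rel_size zG Gf); apply/negP => /size_poly1P[c c0 fE].
  by move: fx; rewrite fE hornerC => /eqP; rewrite (negPf c0).
exists w.
have lead0 q : q != 0 -> forall k, lead_coef q ^+ k != 0 :> K.
  by move=> q0 k; rewrite expf_neq0 // lead_coef_eq0.
have lead0' q q' : pc q q' -> q != 0 -> forall k, lead_coef q' ^+ k != 0 :> Om.
  by move=> Gq q0 k; rewrite expf_neq0 // lead_coef_eq0 -(poly_rel_eq0 zG Gq).
have fwd h h' : pc h h' -> h.[x] = 0 -> h'.[w] = 0.
  move=> Gh hx; have [k [a [a' [r [r' [Ga Gr sr E E']]]]]] := pdiv Gh Gf f0.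
  have r0 : r = 0.
    apply: (minf _ _ Gr) => //; have := congr1 (horner^~ x) E.
    by rewrite hornerZ hx mulr0 hornerD hornerM fx mulr0 add0r.
  have r'0 : r' = 0 by apply/eqP; rewrite -(poly_rel_eq0 zG Gr) r0.
  have := congr1 (horner^~ w) E'; rewrite hornerZ r'0 addr0 hornerM fw mulr0.
  by move/eqP; rewrite mulf_eq0 (negPf (lead0' _ _ Gf f0 k)) => /eqP.
move=> h h' Gh; apply/eqP/eqP; first exact: fwd.
have exm : exists m, `[< exists g g', [/\ pc g g', g != 0, g'.[w] = 0 & size g = m] >].
  by exists (size f); apply/asboolP; exists f, f'.
case: (ex_minnP exm) => m' /asboolP[g [g' [Gg g0 gw gm]]] ming {exm}.
have {}ming g1 g1' : pc g1 g1' -> g1'.[w] = 0 -> (size g1 < size g)%N -> g1 = 0.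
  move=> Gg1 g1w sg; apply/eqP/negPn/negP => g10.
  have /ming : `[< exists g0 g0', [/\ pc g0 g0', g0 != 0, g0'.[w] = 0 & size g0 = size g1] >].
    by apply/asboolP; exists g1, g1'.
  by rewrite -gm leqNgt sg.
have dvd u u' : pc u u' -> u'.[w] = 0 -> exists k a a',
    pc a a' /\ lead_coef g ^+ k *: u = a * g.
  move=> Gu uw; have [k [a [a' [r [r' [Ga Gr sr E E']]]]]] := pdiv Gu Gg g0.
  exists k, a, a'; split=> //; rewrite E (ming _ _ Gr) ?addr0 //.
  have := congr1 (horner^~ w) E'.
  by rewrite hornerZ uw mulr0 hornerD hornerM gw mulr0 add0r.
have gx : g.[x] = 0.
  have [k [q [q' [Gq E]]]] := dvd _ _ Gf fw.
  have := congr1 (horner^~ x) E; rewrite hornerZ fx mulr0 hornerM => /esym/eqP.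
  rewrite mulf_eq0 => /orP[/eqP qx|/eqP //].
  have sE : size f = size (q * g) by rewrite -E size_scale // lead0.
  have q0 : q != 0.
    by apply: contraTneq f0 => q0; rewrite -size_poly_eq0 sE q0 mul0r size_poly0.
  have := minf _ _ Gq qx; rewrite sE size_mul //.
  have : (1 < size g)%N.
    rewrite ltnNge; apply/negP => sg.
    have g'c := size1_polyC sg.
    have := gw; rewrite [g']size1_polyC -?(poly_rel_size zG Gg) // hornerC.
    by move=> /eqP; rewrite -(zG (Gg 0%N)) -polyC_eq0 -g'c (negPf g0).
  case: (size g) => [|[|m1]] // _; rewrite !addnS /= ltnS leq_addr => /(_ isT) qz.
  by rewrite qz eqxx in q0.
move=> hw; have [k [q [q' [Gq E]]]] := dvd _ _ Gh hw.
have := congr1 (horner^~ x) E; rewrite hornerZ hornerM gx mulr0 => /eqP.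
by rewrite mulf_eq0 (negPf (lead0 _ g0 k)) => /eqP.
Qed.

(** Extension of a correspondence that preserves zero to one more element.  When
    [x] is transcendental over the domain of the correspondence, it is sent to an
    element of an ultrapower that is no root of a polynomial over [Om]. *)
Lemma zero_step (x : K) : exists (Om' : fieldType) (phi : {rmorphism Om -> Om'}) (w : Om'),
  GRing.closed_field_axiom Om' /\
  forall u v, adjoin_rel G phi x w u v -> (u == 0) = (v == 0).
Proof.
have [[f [f' [Gf f0 fx]]]|tr] := pselect (exists f f', [/\ pc f f', f != 0 & f.[x] = 0]).
  have [w wP] := algebraic_case Gf f0 fx.
  exists Om, idfun, w; split=> // _ _ [p [q [pq -> ->]]].
  by rewrite map_poly_id // (wP _ _ pq).
have [|F FU HF] := @ultrafilter_of_fip {poly Om} Om [set q | q != 0] (fun q => [set w | q.[w] != 0]).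
  move=> s s0; have p0 : \prod_(q <- s) q != 0.
    rewrite prodf_seq_neq0; apply/allP => q qs; exact: s0.
  have [w] := poly_infinite inf p0; rewrite horner_prod prodf_seq_neq0 => /allP wP.
  by exists w => q qs; apply: wP.
exists (ultrapower Om FU), (udiag FU), (ucls Om FU id); split; first exact: ultra_closed.
move=> _ _ [p [q [pq -> ->]]]; rewrite ucls_horner.
have [p0|p0] := eqVneq p 0.
  have /eqP -> : q == 0 by rewrite -(poly_rel_eq0 zG pq) p0.
  rewrite p0 horner0 eqxx; apply/esym/eqP/ucls_eq0; apply: filterS filterT => w _ /=.
  by rewrite horner0.
have /negPf -> : p.[x] != 0 by apply/eqP => px; apply: tr; exists p, q.
apply/esym/negbTE/eqP => /ucls_eq0 Fq.
have [|w [/= qw]] := filter_ex (filterI Fq (HF q _)); first by rewrite /= -(poly_rel_eq0 zG pq).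
by rewrite qw eqxx.
Qed.
End ZeroStep.

Lemma pchar0_infinite (F : idomainType) : [pchar F] =i pred0 ->
  forall m, exists s : seq F, uniq s /\ size s = m.
Proof.
move=> c0 m; exists [seq i%:R | i <- iota 0 m]; rewrite size_map size_iota; split=> //.
rewrite map_inj_uniq ?iota_uniq // => i j.
wlog ij : i j / (i <= j)%N => [hw|/esym/eqP].
  by case: (leqP i j) => [/hw //|/ltnW/hw H /esym/H].
rewrite -subr_eq0 -natrB //; case Ed: (j - i)%N => [|d].
  by move=> _; apply/eqP; rewrite eqn_leq ij /= -subn_eq0 Ed.
by have /pcharf0P -> := c0.
Qed.

Theorem closed_embedding (R : rcfType) (n : nat) (K : idomainType)
    (iota : {rmorphism R -> K}) (t : 'I_n -> K) :
  exists (Om : fieldType) (rho : {rmorphism R -> Om}) (w : 'I_n -> Om),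
    GRing.closed_field_axiom Om /\ forall p : {mpoly R[n]},
      ((map_mpoly iota p).@[t] == 0) = ((map_mpoly rho p).@[w] == 0).
Proof.
have [Om [rho [G [sG zG Grho [cl wP]]]]] : exists (Om : fieldType)
    (rho : {rmorphism R -> Om}) (G : K -> Om -> Prop), [/\ subring_rel G,
      forall x y, G x y -> (x == 0) = (y == 0), forall c, G (iota c) (rho c) &
      GRing.closed_field_axiom Om /\ {in enum 'I_n, forall i, exists w, G (t i) w}].
  elim: (enum 'I_n) => [|i s [Om [rho [G [sG zG Grho [cl wP]]]]]].
    exists R[i], (real_complex R), (fun x y => exists2 c, x = iota c & y = real_complex R c).
    split; [split| | |].
    - by exists 1; rewrite !rmorph1.
    - by move=> _ _ _ _ [c -> ->] [d -> ->]; exists (c - d); rewrite !rmorphB.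
    - by move=> _ _ _ _ [c -> ->] [d -> ->]; exists (c * d); rewrite !rmorphM.
    - by move=> _ _ [c -> ->]; rewrite !fmorph_eq0.
    - by move=> c; exists c.
    - by split=> //; apply: solve_monicpoly.
  have [|Om' [phi [w [cl' zw]]]] := zero_step cl sG zG _ (t i).
    apply: pchar0_infinite => p; rewrite (fmorph_pchar rho); exact: pchar_num.
  exists Om', (phi \o rho), (adjoin_rel G phi (t i) w).
  split=> //; first exact: adjoin_subring.
    by move=> c; apply: adjoin_sub.
  split=> // j; rewrite inE => /predU1P[->|/wP[w' Gw]]; first by exists w; apply: adjoin_gen.
  by exists (phi w'); apply: adjoin_sub.
have /choice[w {}wP] i : exists w, G (t i) w by apply: wP; rewrite mem_enum.
exists Om, rho, w; split=> // p; apply: zG.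
elim/mpoly_ring_ind: p => [c|i|p q IHp IHq|p q IHp IHq].
- by rewrite !map_mpolyC !mevalC; apply: Grho.
- by rewrite !map_mpolyX !mevalXU; apply: wP.
- by rewrite !(rmorphD (map_mpoly _)) !mevalD; apply: (subrelD sG).
- by rewrite !(rmorphM (map_mpoly _)) !mevalM; apply: (subrelM sG).
Qed.

(** * Maximal formally real subrings are real closed fields *)
Section MaximalReal.
Variable Om : fieldType.

Definition is_subring (A : set Om) :=
  [/\ A 1, (forall x y, A x -> A y -> A (x - y)) & (forall x y, A x -> A y -> A (x * y))].

Definition formally_real (A : set Om) := forall s : seq Om,
  {in s, forall x, A x} -> \sum_(x <- s) x ^+ 2 = 0 -> {in s, forall x, x = 0}.

Record max_real_subring := MaxRealSubring {
  rsub : set Om;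
  rsub_ring : is_subring rsub;
  rsub_real : formally_real rsub;
  rsub_max : forall B, is_subring B -> formally_real B -> rsub `<=` B -> B `<=` rsub;
  rsub_closed : GRing.closed_field_axiom Om
}.

(** Being a formally real subring is a condition on finite sets of elements, so
    it passes to unions of chains; the empty set is admitted in the argument
    below because the union of the empty chain is empty. *)
Lemma exists_max_real_subring (A0 : set Om) : GRing.closed_field_axiom Om ->
  is_subring A0 -> formally_real A0 -> exists L : max_real_subring, A0 `<=` rsub L.
Proof.
move=> cl ring0 real0.
pose P A := A = set0 \/ [/\ is_subring A, formally_real A & A0 `<=` A].
have [|L [PL maxL]] := @Zorn_bigcup _ P.
  move=> F FP Ftot.
  have [[A1 FA1 nA1]|none] := pselect (exists2 A, F A & A !=set0); last first.
    left; apply/seteqP; split=> // x [A FA Ax]; apply: none.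
    by exists A => //; exists x.
  right.
  have good A : F A -> A !=set0 -> [/\ is_subring A, formally_real A & A0 `<=` A].
    by move=> /FP[->|//] [].
  have join (s : seq Om) : {in s, forall x, (\bigcup_(X in F) X) x} ->
      exists A, [/\ F A, A !=set0 & {in s, forall x, A x}].
    elim: s => [|x s IH] H; first by exists A1; split.
    have [|A [FA nA AP]] := IH; first by move=> y ys; apply: H; rewrite inE ys orbT.
    have [B FB Bx] := H x (mem_head _ _).
    have [AB|BA] := Ftot _ _ FA FB.
      exists B; split=> //; first by exists x.
      by move=> y; rewrite inE => /predU1P[->//|/AP/AB].
    exists A; split=> // y; rewrite inE => /predU1P[->|/AP//]; exact: BA.
  have join2 x y : (\bigcup_(X in F) X) x -> (\bigcup_(X in F) X) y ->
      exists A, [/\ F A, A !=set0, A x & A y].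
    move=> Ux Uy; have [|A [FA nA AP]] := join [:: x; y].
      by move=> z; rewrite !inE => /orP[]/eqP->.
    by exists A; split=> //; apply: AP; rewrite !inE eqxx ?orbT.
  split; first split.
  - by have [[A11 _ _] _ _] := good _ FA1 nA1; exists A1.
  - move=> x y Ux Uy; have [A [FA nA Ax Ay]] := join2 _ _ Ux Uy.
    by have [[_ sA _] _ _] := good _ FA nA; exists A => //; apply: sA.
  - move=> x y Ux Uy; have [A [FA nA Ax Ay]] := join2 _ _ Ux Uy.
    by have [[_ _ mA] _ _] := good _ FA nA; exists A => //; apply: mA.
  - move=> s /join[A [FA nA As]]; have [_ rA _] := good _ FA nA; exact: rA.
  - by have [_ _ sA] := good _ FA1 nA1 => x /sA; exists A1.
have [L0|[ringL realL A0L]] := PL.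
  have : L `<` A0.
    by rewrite L0 properEneq; split=> //; apply/eqP => E; case: ring0 => A1 _ _; rewrite -E in A1.
  by move=> /maxL[]; right; split.
have maxL' B : is_subring B -> formally_real B -> L `<=` B -> B `<=` L.
  move=> ringB realB LB; apply: contrapT => nBL.
  by apply: (maxL B); [split|right; split=> //; apply: subset_trans A0L LB].
by exists (MaxRealSubring ringL realL maxL' cl).
Qed.

Section Field.
Variable LL : max_real_subring.
Local Notation L := (rsub LL).

Lemma rsub1 : L 1. Proof. by case: (rsub_ring LL). Qed.
Lemma rsubB x y : L x -> L y -> L (x - y).
Proof. by case: (rsub_ring LL) => _ H _; apply: H. Qed.
Lemma rsubM x y : L x -> L y -> L (x * y).
Proof. by case: (rsub_ring LL) => _ _; apply. Qed.
Lemma rsubX x n : L x -> L (x ^+ n).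
Proof. by move=> Lx; elim: n => [|n IH]; [exact: rsub1|rewrite exprS; apply: rsubM]. Qed.

(** Inverting [x] keeps the ring formally real, by clearing denominators in a
    vanishing sum of squares. *)
Lemma rsubV x : L x -> L x^-1.
Proof.
move=> Lx; have [->|x0] := eqVneq x 0; first by rewrite invr0 -(subrr 1); apply: rsubB; exact: rsub1.
pose B : set Om := [set b | exists N, L (x ^+ N * b)].
have up b N M : L (x ^+ N * b) -> (N <= M)%N -> L (x ^+ M * b).
  by move=> H /subnK <-; rewrite exprD -mulrA; apply: rsubM => //; apply: rsubX.
have : B `<=` L; last by apply; exists 1%N; rewrite expr1 divff //; exact: rsub1.
apply: rsub_max.
- split; first by exists 0%N; rewrite mulr1; exact: rsub1.
    move=> b c [N HN] [M HM]; exists (maxn N M); rewrite mulrBr.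
    by apply: rsubB; [apply: up HN _|apply: up HM _]; rewrite ?leq_maxl ?leq_maxr.
  move=> b c [N HN] [M HM]; exists (N + M)%N.
  by rewrite exprD mulrACA; apply: rsubM.
- move=> s Bs s0.
  have [N HN] : exists N, {in s, forall b, L (x ^+ N * b)}.
    elim: s Bs {s0} => [|b s IH] Bs; first by exists 0%N.
    have [|N HN] := IH; first by move=> c cs; apply: Bs; rewrite inE cs orbT.
    have [M HM] := Bs b (mem_head _ _); exists (maxn N M) => c.
    rewrite inE => /predU1P[->|/HN HN']; first by apply: up HM _; rewrite leq_maxr.
    by apply: up HN' _; rewrite leq_maxl.
  have := @rsub_real LL [seq x ^+ N * b | b <- s].
  rewrite big_map; under eq_bigr => b _ do rewrite exprMn.
  rewrite -mulr_sumr s0 mulr0 => H b bs.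
  have /H : {in [seq x ^+ N * b | b <- s], forall y, L y}.
    by move=> _ /mapP[c cs ->]; apply: HN.
  move=> /(_ erefl _ (map_f _ bs))/eqP.
  by rewrite mulf_eq0 expf_eq0 (negPf x0) andbF => /eqP.
- by move=> b Lb; exists 0%N; rewrite mul1r.
Qed.

Definition rsub_pred : {pred Om} := [pred x | `[< L x >]].
Lemma rsub_divring : divring_closed rsub_pred.
Proof.
split; first exact/asboolP/rsub1.
  by move=> x y /asboolP Lx /asboolP Ly; apply/asboolP/rsubB.
by move=> x y /asboolP Lx /asboolP Ly; apply/asboolP/rsubM => //; apply: rsubV.
Qed.
HB.instance Definition _ := GRing.isDivringClosed.Build Om rsub_pred rsub_divring.

Record real_clos : Type := RealClos { rc_val : Om; rc_valP : rc_val \in rsub_pred }.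
HB.instance Definition _ := [isSub for rc_val].
HB.instance Definition _ := [Choice of real_clos by <:].
HB.instance Definition _ := [SubChoice_isSubComUnitRing of real_clos by <:].
HB.instance Definition _ := [SubComUnitRing_isSubIntegralDomain of real_clos by <:].
HB.instance Definition _ := [SubIntegralDomain_isSubField of real_clos by <:].
Local Notation T := real_clos.
(** The inclusion is made opaque so that simplification does not expand it below
    [map_poly]. *)
Lemma rc_emb_subproof : {f : {rmorphism T -> Om} | forall x, f x = \val x}.
Proof. by exists (\val : {rmorphism T -> Om}). Qed.
Definition rc_emb : {rmorphism T -> Om} := sval rc_emb_subproof.
Lemma rc_embE x : rc_emb x = \val x. Proof. exact: (svalP rc_emb_subproof). Qed.
Local Notation vP := (map_poly rc_emb).
Implicit Types x y a b : T.

Lemma rc_real (s : seq T) : \sum_(x <- s) x ^+ 2 = 0 -> {in s, forall x, x = 0}.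
Proof.
move=> s0 x xs; apply: val_inj; rewrite rmorph0.
have := @rsub_real LL (map val s); apply; last exact: map_f.
  by move=> _ /mapP[y ys ->]; exact/asboolP/rc_valP.
rewrite big_map -[RHS](rmorph0 (\val : T -> Om)) -s0 rmorph_sum.
by apply: eq_bigr => y _; rewrite rmorphXn.
Qed.

(** This is how maximality is used: the elements [(vP h).[th]] form the ring
    generated by [th]. *)
Lemma rc_adjoin (th : Om) :
  (forall hs : seq {poly T}, \sum_(h <- hs) (vP h).[th] ^+ 2 = 0 ->
     {in hs, forall h, (vP h).[th] = 0}) -> exists x, rc_emb x = th.
Proof.
move=> Hth; pose B : set Om := [set u | exists h, u = (vP h).[th]].
suff /(_ th) Lth : B `<=` L.
  have /asboolP Lth' : L th by apply: Lth; exists 'X; rewrite map_polyX hornerX.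
  by exists (RealClos Lth'); exact: rc_embE.
apply: rsub_max.
- split; first by exists 1; rewrite rmorph1 hornerC.
    by move=> _ _ [h ->] [h' ->]; exists (h - h'); rewrite rmorphB !hornerE.
  by move=> _ _ [h ->] [h' ->]; exists (h * h'); rewrite rmorphM !hornerE.
- move=> s Bs s0.
  have [hs sE] : exists hs : seq {poly T}, s = [seq (vP h).[th] | h <- hs].
    elim: s Bs {s0} => [|u s IH] Bs; first by exists [::].
    have [|hs ->] := IH; first by move=> c cs; apply: Bs; rewrite inE cs orbT.
    by have [h ->] := Bs u (mem_head _ _); exists (h :: hs).
  move: s0; rewrite sE big_map => /Hth hs0 _ /mapP[h hin ->]; exact: hs0.
- move=> u /asboolP Lu; exists (RealClos Lu)%:P.
  by rewrite map_polyC hornerC; exact/esym/rc_embE.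
Qed.

Definition sos x := exists s : seq T, x = \sum_(y <- s) y ^+ 2.
Lemma sosD x y : sos x -> sos y -> sos (x + y).
Proof. by move=> [s ->] [t ->]; exists (s ++ t); rewrite big_cat. Qed.
Lemma sosM x y : sos x -> sos y -> sos (x * y).
Proof.
move=> [s ->] [t ->]; exists [seq u * v | u <- s, v <- t].
rewrite big_allpairs_dep /= mulr_suml; apply: eq_bigr => u _.
by rewrite mulr_sumr; apply: eq_bigr => v _; rewrite exprMn.
Qed.
Lemma sos_sqr x : sos (x ^+ 2).
Proof. by exists [:: x]; rewrite big_seq1. Qed.
Lemma sos_eq0 x y : sos x -> sos y -> x + y = 0 -> x = 0.
Proof.
move=> [s ->] [t ->]; rewrite -big_cat => /rc_real H.
by rewrite big_seq big1 // => u us; rewrite (H u) ?expr0n // mem_cat us.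
Qed.

(** If [a] has no square root in [T], adjoining one destroys formal reality: a
    vanishing sum of squares of elements [x + y * sqrt a] has its rational part
    [X + a * Y] equal to zero. *)
Lemma not_square_sos a : ~ (exists b, a = b ^+ 2) ->
  exists X Y, [/\ sos X, sos Y, Y != 0 & X + a * Y = 0].
Proof.
move=> nsq.
have [r] := @closed_root Om ('X^2 - (rc_emb a)%:P) (rsub_closed LL) ltac:(by rewrite size_XnsubC).
rewrite /root !hornerE subr_eq0 => /eqP r2.
have nr : ~ (exists x, rc_emb x = r).
  by move=> [x xr]; case: nsq; exists x; apply: (fmorph_inj rc_emb); rewrite rmorphXn xr -r2.
have lin (h : {poly T}) : exists x y, (vP h).[r] = rc_emb x + rc_emb y * r.
  elim/poly_ind: h => [|h c [x [y E]]].
    by exists 0, 0; rewrite !rmorph0 horner0 mul0r addr0.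
  exists (a * y + c), x.
  rewrite rmorphD rmorphM /= map_polyX map_polyC !hornerE E.
  by rewrite rmorphD rmorphM -r2; ring.
have [hs [hs0 [h0 h0in h0n]]] : exists hs : seq {poly T},
    \sum_(h <- hs) (vP h).[r] ^+ 2 = 0 /\ exists2 h, h \in hs & (vP h).[r] <> 0.
  apply: contrapT => Hn; apply: nr; apply: rc_adjoin => hs hs0 h hin.
  by apply: contrapT => h0; apply: Hn; exists hs; split=> //; exists h.
have /choice[f fP] (h : {poly T}) : exists xy : T * T,
    (vP h).[r] = rc_emb xy.1 + rc_emb xy.2 * r.
  by have [x [y E]] := lin h; exists (x, y).
pose X := \sum_(x <- [seq (f h).1 | h <- hs]) x ^+ 2.
pose Y := \sum_(x <- [seq (f h).2 | h <- hs]) x ^+ 2.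
pose Z := \sum_(h <- hs) ((f h).1 * (f h).2) *+ 2.
have E : rc_emb (X + a * Y) + rc_emb Z * r = 0.
  rewrite -[RHS]hs0 /X /Y /Z !big_map !(rmorphD, rmorphM, rmorph_sum).
  rewrite mulr_sumr mulr_suml -!big_split /=; apply: eq_bigr => h _.
  by rewrite fP !(rmorphXn, rmorphMn, rmorphM) -r2; ring.
have Z0 : Z = 0.
  apply/eqP/negPn/negP => Z0; apply: nr; exists (- (X + a * Y) / Z).
  apply: (mulfI (x := rc_emb Z)); first by rewrite fmorph_eq0.
  rewrite -rmorphM mulrC divfK // rmorphN; apply/eqP.
  by rewrite eq_sym -addr_eq0 addrC E.
have XY : X + a * Y = 0.
  by apply/eqP; rewrite -(fmorph_eq0 rc_emb) -E Z0 rmorph0 mul0r addr0.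
exists X, Y; split=> //; [by eexists|by eexists|].
apply/eqP => Y0; apply: h0n; rewrite fP.
have /rc_real/(_ _ (map_f _ h0in)) -> : X = 0 by rewrite -XY Y0 mulr0 addr0.
by have /rc_real/(_ _ (map_f _ h0in)) -> := Y0; rewrite !rmorph0 mul0r addr0.
Qed.

(** Otherwise both [- a] and [a] would be quotients of sums of squares, by
    [not_square_sos], and so would their product be, which is minus a square. *)
Lemma rc_square a : (exists b, a = b ^+ 2) \/ (exists b, - a = b ^+ 2).
Proof.
apply: contrapT => /not_orP[nsq nsq'].
have [X [Y [sX sY Y0 E]]] := not_square_sos nsq.
have [X' [Y' [sX' sY' Y'0 E']]] := not_square_sos nsq'.
have XY' : X * Y' = 0.
  apply: (@sos_eq0 _ (X' * Y)); [exact: sosM|exact: sosM|].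
  rewrite [LHS](_ : _ = (X + a * Y) * Y' + (X' + - a * Y') * Y); last by ring.
  by rewrite E E' !mul0r addr0.
move/eqP: XY'; rewrite mulf_eq0 (negPf Y'0) orbF => /eqP X0.
move/eqP: E; rewrite X0 add0r mulf_eq0 (negPf Y0) orbF => /eqP a0.
by apply: nsq; exists 0; rewrite a0 expr0n.
Qed.

(** By [rc_square] the squares are the positive cone of a total order. *)
Definition rc_le x y : bool := `[< exists b, y - x = b ^+ 2 >].
Definition rc_lt x y : bool := (y != x) && rc_le x y.
Definition rc_norm x : T := if rc_le 0 x then x else - x.

Lemma rc_le0P x : reflect (exists b, x = b ^+ 2) (rc_le 0 x).
Proof. by apply: (iffP (asboolP _)); rewrite subr0. Qed.
Lemma rc_ge0P x : reflect (exists b, - x = b ^+ 2) (rc_le x 0).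
Proof. by apply: (iffP (asboolP _)); rewrite sub0r. Qed.
Lemma rc_le0_anti x : rc_le 0 x -> rc_le x 0 -> x = 0.
Proof.
move=> /rc_le0P[b xb] /rc_ge0P[c xc]; rewrite xb.
by apply: (@sos_eq0 _ (c ^+ 2)); [exact: sos_sqr|exact: sos_sqr|rewrite -xb -xc subrr].
Qed.
Lemma rc_le0_add x y : rc_le 0 x -> rc_le 0 y -> rc_le 0 (x + y).
Proof.
move=> /rc_le0P[b xb] /rc_le0P[c yc]; apply/rc_le0P.
have [//|[d xyd]] := rc_square (x + y).
have s1 : sos (x + y) by apply: sosD; rewrite ?xb ?yc; apply: sos_sqr.
have := sos_eq0 s1 (sos_sqr d); rewrite -xyd subrr => /(_ erefl) ->.
by exists 0; rewrite expr0n.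
Qed.
Lemma rc_le0_mul x y : rc_le 0 x -> rc_le 0 y -> rc_le 0 (x * y).
Proof.
move=> /rc_le0P[b ->] /rc_le0P[c ->]; apply/rc_le0P; exists (b * c).
by rewrite exprMn.
Qed.
Lemma rc_sub_ge0 x y : rc_le 0 (y - x) = rc_le x y.
Proof. by rewrite /rc_le subr0. Qed.
Lemma rc_le0_total x : rc_le 0 x || rc_le x 0.
Proof.
by apply/orP; case: (rc_square x) => H; [left; apply/rc_le0P|right; apply/rc_ge0P].
Qed.
Lemma rc_normN x : rc_norm (- x) = rc_norm x.
Proof.
have E : rc_le 0 (- x) = rc_le x 0 by rewrite -[RHS]rc_sub_ge0 sub0r.
rewrite /rc_norm E opprK; have := rc_le0_total x.
case Hx: (rc_le x 0); case H0: (rc_le 0 x) => //= _.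
by rewrite (rc_le0_anti H0 Hx) oppr0.
Qed.
Lemma rc_ge0_norm x : rc_le 0 x -> rc_norm x = x.
Proof. by rewrite /rc_norm => ->. Qed.

HB.instance Definition _ := Num.IntegralDomain_isLeReal.Build real_clos
  rc_le0_add rc_le0_mul rc_le0_anti rc_sub_ge0 rc_le0_total rc_normN rc_ge0_norm
  (fun x y => erefl).

Implicit Types p q h : {poly T}.

Lemma poly_sum_sqr_eq0 (hs : seq {poly T}) :
  \sum_(h <- hs) h ^+ 2 = 0 -> {in hs, forall h, h = 0}.
Proof.
move=> hs0 h hin; apply/eqP/negPn/negP => h0.
have [|c] := poly_infinite _ h0; first exact/pchar0_infinite/pchar_num.
have := @rc_real [seq g.[c] | g <- hs]; rewrite big_map.
under eq_bigr => g _ do rewrite -horner_exp.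
rewrite -horner_sum hs0 horner0 => /(_ erefl _ (map_f _ hin)) ->.
by rewrite eqxx.
Qed.

Lemma horner0_factor p c : p.[c] = 0 -> exists q, p = ('X - c%:P) * q.
Proof. by move=> /rootP/factor_theorem[q ->]; exists q; rewrite mulrC. Qed.

Lemma size_factor q c : ('X - c%:P) * q != 0 -> (size q < size (('X - c%:P) * q)%R)%N.
Proof.
move=> H; have q0 : q != 0 by apply: contraNneq H => ->; rewrite mulr0.
by rewrite size_mul ?polyXsubC_eq0 // size_XsubC.
Qed.

(** The intermediate value property is proved by strong induction on the size.
    In this section [p] changes sign between [a] and [b] but has no root there,
    whereas the property holds for smaller polynomials. *)
Section IvtStep.
Variables (p : {poly T}) (a b : T).
Hypothesis (ab : a <= b) (pa : p.[a] < 0) (pb : 0 < p.[b]).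
Hypothesis noroot : forall c, a <= c <= b -> p.[c] != 0.
Hypothesis IH : forall q, (size q < size p)%N -> q.[a] <= 0 <= q.[b] ->
  exists2 c, a <= c <= b & q.[c] = 0.

Let p0 : p != 0.
Proof. by apply: contraTneq pb => ->; rewrite horner0 ltxx. Qed.

Lemma ivt_prod q : (size q < size p)%N -> q.[a] * q.[b] <= 0 ->
  exists2 c, a <= c <= b & q.[c] = 0.
Proof.
move=> sq qab; have [qa|qa] := leP q.[a] 0.
  have [qb|qb] := leP 0 q.[b]; first by apply: IH => //; rewrite qa.
  have [qa0|qa0] := eqVneq q.[a] 0; first by exists a; rewrite ?lexx.
  have : 0 < q.[a] * q.[b] by rewrite nmulr_rgt0 // lt_neqAle qa0.
  by rewrite ltNge qab.
have qb : q.[b] <= 0 by rewrite -(pmulr_rle0 _ qa).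
have [||c cab] := IH (q := - q); first by rewrite size_polyN.
  by rewrite !hornerN oppr_le0 oppr_ge0 (ltW qa).
by rewrite hornerN => /eqP; rewrite oppr_eq0 => /eqP; exists c.
Qed.

(** A proper factor of [p] that changes sign would have a root in [[a, b]]. *)
Lemma ivt_irred u v : p = u * v -> (size u < size p)%N -> (size v < size p)%N -> False.
Proof.
move=> puv su sv.
have main w w' : p = w * w' -> (size w < size p)%N -> w.[a] * w.[b] <= 0 -> False.
  move=> pw sw /(ivt_prod sw)[c cab wc]; have := noroot cab.
  by rewrite pw hornerM wc mul0r eqxx.
have [uab|uab] := leP (u.[a] * u.[b]) 0; first exact: main puv su uab.
apply: (main v u _ sv); first by rewrite mulrC.
rewrite -(pmulr_rle0 _ uab) mulrACA -!hornerM -puv.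
by rewrite nmulr_rle0 // ltW.
Qed.

(** The ring generated by a root of [p] is formally real.  In a relation
    [sum h^2 = p * q] with all [h] smaller than [p], the cofactor [q] is smaller
    than [p] and changes sign like [p], so it has a root [c].  All [h] vanish at
    [c], and dividing by the square of ['X - c] gives a relation with a smaller
    cofactor. *)
Lemma ivt_descent (m : nat) q (hs : seq {poly T}) : (size q <= m)%N ->
  {in hs, forall h, (size h < size p)%N} -> \sum_(h <- hs) h ^+ 2 = p * q ->
  {in hs, forall h, h = 0}.
Proof.
elim: m q hs => [|m IHm] q hs sq sh E.
  move: sq; rewrite leqn0 size_poly_eq0 => /eqP q0.
  by apply: poly_sum_sqr_eq0; rewrite E q0 mulr0.
have [q0|q0] := eqVneq q 0; first by apply: poly_sum_sqr_eq0; rewrite E q0 mulr0.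
have sp : (0 < size p)%N by rewrite size_poly_gt0.
have spq : (size q < size p)%N.
  have : (size (p * q)%R <= (size p).-1.*2.-1)%N.
    rewrite -E; apply: (leq_trans (size_sum _ _ _)); apply/bigmax_leqP_seq => h hin _.
    apply: (leq_trans (size_polyMleq _ _)); have := sh h hin.
    by rewrite -!muln2; lia.
  rewrite size_mul // => H; have sq0 : (0 < size q)%N by rewrite size_poly_gt0.
  by move: (size p) (size q) H sp sq0 => [|[|P]] Q; rewrite -?muln2; lia.
have ge0 c : 0 <= p.[c] * q.[c].
  rewrite -hornerM -E horner_sum; apply: sumr_ge0 => h _.
  by rewrite horner_exp sqr_ge0.
have [|c cab qc] := IH spq.
  by rewrite -(nmulr_rge0 q.[a] pa) -(pmulr_rge0 q.[b] pb) !ge0.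
have hc h : h \in hs -> h.[c] = 0.
  move=> hin; have := @rc_real [seq g.[c] | g <- hs]; rewrite big_map.
  under eq_bigr => g _ do rewrite -horner_exp.
  by rewrite -horner_sum E hornerM qc mulr0 => /(_ erefl _ (map_f _ hin)).
have [q1 qE] := horner0_factor qc.
have /choice[f fP] (h : {poly T}) : exists h1, h \in hs -> h = ('X - c%:P) * h1.
  have [hin|hin] := boolP (h \in hs); last by exists 0.
  by have [h1 h1E] := horner0_factor (hc h hin); exists h1.
have X0 : 'X - c%:P != 0 :> {poly T} by rewrite polyXsubC_eq0.
have E1 : ('X - c%:P) * (\sum_(h <- hs) f h ^+ 2) = p * q1.
  apply: (mulfI X0); rewrite mulrA -expr2 mulr_sumr mulrCA -qE -E.
  by apply: eq_big_seq => h hin; rewrite [h in RHS](fP h hin) exprMn.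
have q1c : q1.[c] = 0.
  have := congr1 (horner^~ c) E1; rewrite !hornerE subrr mul0r => /esym/eqP.
  by rewrite mulf_eq0 (negPf (noroot cab)) => /eqP.
have [q2 q1E] := horner0_factor q1c.
have sq2 : (size q2 <= m)%N.
  rewrite -ltnS (leq_trans _ sq) // qE q1E.
  apply: (ltn_trans (n := size (('X - c%:P) * q2)%R)); apply: size_factor.
    by rewrite -q1E; apply: contraNneq q0 => q10; rewrite qE q10 mulr0.
  by rewrite -q1E -qE.
have := IHm q2 [seq f h | h <- hs] sq2.
have f0 h : h \in hs -> f h = 0 -> h = 0 by move=> /fP hE f0; rewrite hE f0 mulr0.
move=> H h hin; apply: f0 => //; apply: H (map_f _ hin).
  move=> _ /mapP[g gin ->]; have [->|fg0] := eqVneq (f g) 0.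
    by rewrite size_poly0.
  apply: ltn_trans (sh g gin); rewrite [g in X in (_ < X)%N](fP g gin).
  by apply: size_factor; rewrite mulf_neq0.
by rewrite big_map; apply: (mulfI X0); rewrite E1 q1E mulrCA.
Qed.

(** A root [th] of [p] in the algebraically closed field generates a formally
    real ring, hence lies in [T].  Then [p] has a linear factor; its cofactor is
    smaller and changes sign, as [th] is not between [a] and [b]. *)
Lemma ivt_contra : False.
Proof.
have sp1 : size p != 1%N.
  apply/negP => /size_poly1P[c c0 pc]; move: pa pb; rewrite pc !hornerC => c1 c2.
  by move: (lt_trans c1 c2); rewrite ltxx.
have [|th /rootP pth] := @closed_root Om (vP p) (rsub_closed LL).
  by rewrite size_map_poly.
have dvd h : (vP h).[th] = 0 -> p %| h.
  move=> hth; have g0 : gcdp p h != 0 by rewrite gcdp_eq0 (negPf p0).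
  have sg : (1 < size (gcdp p h))%N.
    have : root (vP (gcdp p h)) th.
      by rewrite gcdp_map root_gcd /root pth hth eqxx.
    apply: contraTT; rewrite -leqNgt => /size1_polyC gE.
    rewrite gE map_polyC rootC fmorph_eq0 -polyC_eq0 -gE //.
  have [q pE] := dvdpP _ _ (dvdp_gcdl p h).
  have := size_mul (p := q) (q := gcdp p h); rewrite -pE => /(_ _ g0) sE.
  have q0 : q != 0 by apply: contraNneq p0 => q0; rewrite pE q0 mul0r.
  have [gp|gp] := ltnP (size (gcdp p h)) (size p).
    case: (ivt_irred pE _ gp); rewrite sE // -subn1.
    by move: (size q) (size (gcdp p h)) sg => x y; lia.
  have : gcdp p h %= p by rewrite -dvdp_size_eqp ?dvdp_gcdl // eqn_leq gp dvdp_leq ?dvdp_gcdl.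
  by rewrite /eqp => /andP[_ pg]; apply: dvdp_trans pg (dvdp_gcdr _ _).
have hmod h : (vP (h %% p)).[th] = (vP h).[th].
  by rewrite [in RHS](divp_eq h p) rmorphD rmorphM !hornerE /= pth mulr0 add0r.
have [|c cth] := @rc_adjoin th.
  move=> hs hs0 h hin; rewrite -hmod.
  have : p %| \sum_(g <- [seq g %% p | g <- hs]) g ^+ 2.
    apply: dvd; rewrite big_map rmorph_sum horner_sum -[RHS]hs0.
    by apply: eq_bigr => g _; rewrite rmorphXn horner_exp /= hmod.
  move=> /dvdpP[q qE]; rewrite mulrC in qE.
  have sm : {in [seq g %% p | g <- hs], forall g : {poly T}, (size g < size p)%N}.
    by move=> _ /mapP[g _ ->]; rewrite ltn_modp.
  have := ivt_descent (leqnn _) sm qE (map_f _ hin) => ->.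
  by rewrite rmorph0 horner0.
have pc : p.[c] = 0.
  by apply: (fmorph_inj rc_emb); rewrite rmorph0 -horner_map cth.
have [q pE] := horner0_factor pc.
have sq : (size q < size p)%N by rewrite pE size_factor // -pE.
suff : q.[a] * q.[b] <= 0.
  move=> /(ivt_prod sq)[d dab qd]; have := noroot dab.
  by rewrite pE hornerM qd mulr0 eqxx.
have cab : 0 < (a - c) * (b - c).
  have [ac|ca] := ltP c a.
    by rewrite mulr_gt0 // subr_gt0 // (lt_le_trans ac).
  have [cb|bc] := leP c b; first by have := noroot (c := c); rewrite ca cb pc eqxx => /(_ isT).
  by rewrite nmulr_rgt0 ?subr_lt0 // (le_lt_trans ab).
have hor x : x - c = ('X - c%:P).[x] by rewrite hornerXsubC.
rewrite -(pmulr_rle0 _ cab) mulrACA !hor -!hornerM -pE.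
by rewrite nmulr_rle0 // ltW.
Qed.
End IvtStep.

Lemma rc_ivt : Num.real_closed_axiom real_clos.
Proof.
move=> p; have [n] := ubnP (size p); elim: n p => // n IHn p sp a b ab /andP[pa pb].
have [pa0|pa0] := eqVneq p.[a] 0; first by exists a; rewrite ?lexx //; apply/rootP.
have [pb0|pb0] := eqVneq p.[b] 0; first by exists b; rewrite ?lexx ?ab //; apply/rootP.
apply: contrapT => Hn; apply: (@ivt_contra p a b ab).
- by rewrite lt_neqAle pa0.
- by rewrite lt_neqAle eq_sym pb0.
- by move=> c cab; apply/eqP => /rootP pc; apply: Hn; exists c.
- move=> q sq qab; have [|c cab /rootP qc] := IHn q _ a b ab qab; last by exists c.
  exact: leq_trans sq _.
Qed.

HB.instance Definition _ := Num.RealField_isClosed.Build real_clos rc_ivt.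
End Field.
End MaximalReal.

(** * Hilbert basis theorem *)
Section Dickson.
Local Open Scope nat_scope.

(** The next index is a place where the tail attains its minimum. *)
Lemma monotone_subseq (f : nat -> nat) : exists2 phi : nat -> nat,
  forall k, phi k < phi k.+1 & forall k, f (phi k) <= f (phi k.+1).
Proof.
have /choice[g gP] (N : nat) : exists j, N <= j /\ forall i, N <= i -> f j <= f i.
  have ex : exists m, `[< exists2 j, N <= j & f j = m >] by exists (f N); apply/asboolP; exists N.
  case: (ex_minnP ex) => m /asboolP[j Nj fj] minm; exists j; split=> // i Ni.
  by rewrite fj; apply: minm; apply/asboolP; exists i.
pose st k := iter k (fun N => (g N).+1) 0.
exists (fun k => g (st k)) => k.
  by rewrite [st k.+1]/=; have [] := gP (g (st k)).+1.
have [_] := gP (st k); apply; rewrite [st k.+1]/=.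
have [h1 _] := gP (st k); have [h2 _] := gP (g (st k)).+1.
by rewrite (leq_trans h1) // ltnW.
Qed.

Lemma monotone_subseq_fin (I : eqType) (s : seq I) (f : I -> nat -> nat) :
  exists2 phi : nat -> nat, forall k, phi k < phi k.+1 &
    {in s, forall i k, f i (phi k) <= f i (phi k.+1)}.
Proof.
elim: s => [|i s [phi incr mon]]; first by exists id.
have [psi incr' mon'] := monotone_subseq (f i \o phi).
have mono (u : nat -> nat) : (forall k, u k <= u k.+1) -> {homo u : a b / a <= b}.
  exact: homo_leq leqnn leq_trans.
exists (phi \o psi) => [k|j].
  have /= := mono phi (fun k => ltnW (incr k)) _ _ (incr' k).
  exact: leq_trans (incr _).
rewrite inE => /predU1P[->|/mon js] k; first exact: mon'.
by apply: (mono (fun l => f j (phi l)) js); apply: ltnW.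
Qed.

(** Otherwise one could choose an infinite sequence in which no monomial divides
    a later one, against [monotone_subseq_fin]. *)
Lemma dickson n (M : set 'X_{1..n}) : exists s : seq 'X_{1..n},
  {in s, forall m, M m} /\ forall m, M m -> exists2 m', m' \in s & (m' <= m)%MM.
Proof.
apply: contrapT => none.
have /choice[h hP] (s : seq 'X_{1..n}) : exists m, {in s, forall m', M m'} ->
    M m /\ {in s, forall m', ~~ (m' <= m)%MM}.
  have [sM|nsM] := pselect {in s, forall m', M m'}; last by exists 0%MM.
  apply: contrapT => nm; apply: none; exists s; split=> // m Mm.
  apply: contrapT => H; apply: nm; exists m => _; split=> // m' m's.
  by apply/negP => H'; apply: H; exists m'.
pose S k := iter k (fun s => h s :: s) [::]; pose f k := h (S k).
have SM k : {in S k, forall m', M m'}.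
  elim: k => [|k IH] m' //; rewrite inE => /predU1P[->|/IH //].
  by have [] := hP _ IH.
have fS j k : j < k -> f j \in S k.
  by elim: k => // k IH; rewrite ltnS leq_eqVlt inE => /predU1P[->|/IH ->]; rewrite ?eqxx ?orbT.
have [phi incr mon] := monotone_subseq_fin (enum 'I_n) (fun i k => f k i).
have [_ /(_ (f (phi 0)) (fS _ _ (incr 0)))/negP] := hP _ (SM (phi 1)); apply.
by apply/mnm_lepP => i; apply: mon; rewrite mem_enum.
Qed.
End Dickson.

(** The basis consists of elements whose leading monomials are those of
    [dickson]; reduction of the leading term then proves generation.  It is
    stated as the fact that a morphism kills the ideal once it kills the basis,
    which is how it is used and spares the coefficients. *)
Lemma hilbert_basis (K : fieldType) n (I : ideal {mpoly K[n]}) :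
  exists ps : seq {mpoly K[n]}, {in ps, forall p, p \in I} /\
   forall (A : comNzRingType) (f : {rmorphism {mpoly K[n]} -> A}),
     {in ps, forall p, f p = 0} -> {in I, forall p, f p = 0}.
Proof.
have [s [sM sP]] := dickson [set m | exists2 p : {mpoly K[n]}, p \in I & p != 0 /\ mlead p = m].
have /choice[g gP] m : exists p : {mpoly K[n]}, m \in s -> [/\ p \in I, p != 0 & mlead p = m].
  have [/sM[p pI [p0 pm]]|] := boolP (m \in s); first by exists p.
  by exists 0.
exists (map g s); split=> [_ /mapP[m /gP[? _ _] ->] //|A f fps p].
elim/mleadrect: p => p IH pI.
have [->|p0] := eqVneq p 0; first by rewrite rmorph0.
have [|m' m's m'p] := sP (mlead p); first by exists p.
have [gI g0 gm] := gP m' m's.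
pose u := (mleadc p / mleadc (g m')) *: 'X_[mlead p - m'] : {mpoly K[n]}.
have c0 : mleadc p / mleadc (g m') != 0 by rewrite mulf_neq0 ?invr_eq0 ?mleadc_eq0.
have X0 : 'X_[mlead p - m'] != 0 :> {mpoly K[n]} by rewrite -mleadc_eq0 mleadXm mcoeffX eqxx oner_eq0.
have u0 : u != 0 by rewrite scaler_eq0 negb_or c0.
have lu : mlead (u * g m') = mlead p.
  by rewrite mleadM // mleadZ // mleadXm gm addmC addmBA // addmC addmK.
have cu : mleadc (u * g m') = mleadc p.
  rewrite mleadM // mleadcM mleadcZE mleadXm mcoeffX eqxx mulr1.
  by rewrite divfK // mleadc_eq0.
have fg : f (g m') = 0 by apply: fps; apply: map_f.
have qI : p - u * g m' \in I by rewrite rpredB // idealMl.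
suff : f (p - u * g m') = 0 by rewrite rmorphB rmorphM fg mulr0 subr0.
have [->|q0] := eqVneq (p - u * g m') 0; first by rewrite rmorph0.
apply: IH => //; rewrite lt_neqAle; apply/andP; split.
  apply: contraNneq q0 => E; rewrite -mleadc_eq0 E mcoeffB -{2}lu cu subrr //.
by have := mleadB_le p (u * g m'); rewrite lu joinxx.
Qed.

(** * Real Nullstellensatz *)

(** The quotient by a prime ideal as an integral domain.  Its structure demands
    a notion of unit, which is defined by the existence of an inverse. *)
Section DomainQuotient.
Variables (A : comPzRingType) (P : primeIdeal A).

Definition domain_quotient : Type := ideal_quotient P.
HB.instance Definition _ := GRing.ComPzRing.on domain_quotient.
Definition domain_proj : {rmorphism A -> domain_quotient} := quot_proj P.

Lemma domain_proj_eq0 a : (domain_proj a == 0) = (a \in P).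
Proof.
apply/eqP/idP; first by rewrite -(rmorph0 domain_proj) => /quot_projP; rewrite subr0.
by move=> Pa; rewrite -(rmorph0 domain_proj); apply/quot_projP; rewrite subr0.
Qed.

Lemma domain_proj_surj x : exists a, domain_proj a = x.
Proof. by eexists; apply: (@quot_proj_surj _ P). Qed.

Lemma dq_neq0 : (1 : domain_quotient) != 0.
Proof. by rewrite -(rmorph1 domain_proj) domain_proj_eq0 prime_ideal1. Qed.
HB.instance Definition _ := GRing.PzSemiRing_isNonZero.Build domain_quotient dq_neq0.

Definition dq_unit : {pred domain_quotient} := [pred x | `[< exists y, y * x = 1 >]].
Lemma dq_inv_ex (x : domain_quotient) : exists y, (x \in dq_unit -> y * x = 1) /\ (x \notin dq_unit -> y = x).
Proof.
by have [/asboolP[y yx]|xn] := boolP (x \in dq_unit); [exists y|exists x].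
Qed.
Definition dq_inv x := sval (cid (dq_inv_ex x)).
Lemma dq_mulVx : {in dq_unit, left_inverse 1 dq_inv *%R}.
Proof. by move=> x xu; rewrite /dq_inv; case: cid => y [H _] /=; apply: H. Qed.
Lemma dq_unitPl x y : y * x = 1 -> x \in dq_unit.
Proof. by move=> yx; apply/asboolP; exists y. Qed.
Lemma dq_invr_out : {in [predC dq_unit], dq_inv =1 id}.
Proof. by move=> x xu; rewrite /dq_inv; case: cid => y [_ H] /=; apply: H. Qed.
HB.instance Definition _ := GRing.ComNzRing_hasMulInverse.Build domain_quotient
  dq_mulVx dq_unitPl dq_invr_out.

Lemma dq_integral : GRing.integral_domain_axiom domain_quotient.
Proof.
move=> x y; have [a <-] := domain_proj_surj x; have [b <-] := domain_proj_surj y.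
by rewrite -rmorphM => /eqP; rewrite !domain_proj_eq0 => /prime_idealM[] ->; rewrite ?orbT.
Qed.
HB.instance Definition _ := GRing.ComUnitRing_isIntegral.Build domain_quotient dq_integral.
End DomainQuotient.

Lemma meval_map_morph (R A : comNzRingType) n (f : {rmorphism {mpoly R[n]} -> A})
    (iota : {rmorphism R -> A}) (p : {mpoly R[n]}) :
  (forall c, iota c = f c%:MP) -> (map_mpoly iota p).@[fun i => f 'X_i] = f p.
Proof.
move=> fC; elim/mpoly_ring_ind: p => [c|i|p q IHp IHq|p q IHp IHq].
- rewrite -fC; by rewrite map_mpolyC mevalC.
- by rewrite map_mpolyX mevalXU.
- by rewrite !rmorphD /= IHp IHq.
- by rewrite !rmorphM /= IHp IHq.
Qed.

Section RealNullstellensatz.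
Variables (R : rcfType) (n : nat) (P : primeIdeal {mpoly R[n]}).
Hypothesis realP : real_ideal P.
Implicit Types p g : {mpoly R[n]}.

Lemma real_prime_rcf : exists (L : rcfType) (e : {rmorphism {mpoly R[n]} -> L}),
  forall p, (e p == 0) = (p \in P).
Proof.
pose iota : {rmorphism R -> domain_quotient P} := (domain_proj P \o (@mpolyC n R)).
have [Om [rho [w [cl E]]]] := closed_embedding iota (fun i => domain_proj P 'X_i).
pose e : {rmorphism {mpoly R[n]} -> Om} := (meval w \o map_mpoly rho).
have eE p : (e p == 0) = (p \in P).
  by rewrite /= -E meval_map_morph ?domain_proj_eq0.
pose A0 : set Om := range e.
have [||LL A0L] := @exists_max_real_subring _ A0 cl.
- split; first by exists 1; rewrite ?rmorph1.
    by move=> _ _ [p _ <-] [q _ <-]; exists (p - q); rewrite ?rmorphB.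
  by move=> _ _ [p _ <-] [q _ <-]; exists (p * q); rewrite ?rmorphM.
- move=> s sA s0.
  have [ps sE] : exists ps : seq {mpoly R[n]}, s = [seq e p | p <- ps].
    elim: s sA {s0} => [|u s IH] sA; first by exists [::].
    have [|ps ->] := IH; first by move=> c cs; apply: sA; rewrite inE cs orbT.
    by have [p _ <-] := sA u (mem_head _ _); exists (p :: ps).
  have sP : \sum_(p <- ps) p ^+ 2 \in P.
    rewrite -eE; apply/eqP; rewrite rmorph_sum -[RHS]s0 sE big_map.
    by apply: eq_bigr => p _; rewrite rmorphXn.
  move=> x; rewrite sE => /mapP[p pin ->]; apply/eqP; rewrite eE.
  exact: realP sP _ pin.
have eL p : e p \in rsub_pred LL by apply/asboolP/A0L; exists p.
pose eT p : real_clos LL := RealClos (eL p).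
have eT_zmod : zmod_morphism eT by move=> p q; apply: val_inj; rewrite /= !rmorphB.
have eT_monoid : monoid_morphism eT.
  by split=> [|p q]; apply: val_inj; rewrite /= ?rmorph1 // !rmorphM.
pose eT' : {rmorphism {mpoly R[n]} -> real_clos LL} :=
  HB.pack eT (GRing.isZmodMorphism.Build _ _ eT eT_zmod)
             (GRing.isMonoidMorphism.Build _ _ eT eT_monoid).
exists (real_clos LL : rcfType), eT' => p.
by rewrite -eE.
Qed.

(** The variables, seen in a real closed field that contains the residue ring,
    are a zero of [P] and not of [g]; a basis of [P] makes this a finite system,
    which then has a solution in [R]. *)
Theorem real_nullstellensatz g : g \notin P ->
  exists2 v : 'I_n -> R, {in P, forall p, p.@[v] = 0} & g.@[v] != 0.
Proof.
move=> gP; have [L [e eE]] := real_prime_rcf.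
have [ps [psP basis]] := hilbert_basis P.
pose iota : {rmorphism R -> L} := (e \o (@mpolyC n R)).
have ev p : (map_mpoly iota p).@[fun i => e 'X_i] = e p by apply: meval_map_morph.
have [||v psv gv] := @rcf_ex_closed R n L iota ps g (fun i => e 'X_i).
- by move=> p /psP pP; rewrite ev; apply/eqP; rewrite eE.
- by rewrite ev eE.
by exists v => // p pP; apply: (basis _ (meval v)).
Qed.
End RealNullstellensatz.

(** * Extension of complex points along an integral morphism *)
Definition is_ideal (E : comPzRingType) (M : set E) :=
  [/\ M 0, (forall x y, M x -> M y -> M (x - y)) & (forall a x, M x -> M (a * x))].

(** An integral equation of [b] multiplied by the power [psi d ^+ k] is an
    equation for [b * psi d], which may be replaced by [psi s] modulo [M].  This
    is the step where integrality is used, both to extend points and to see that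
    maximal ideals lie over the given prime. *)
Lemma integral_congruence (D E : comPzRingType) (psi : {rmorphism D -> E})
    (M : set E) (b : E) (s d : D) :
  is_ideal M -> integral_over psi b -> M (psi s - b * psi d) ->
  exists k (c : 'I_k -> D),
    M (psi (s ^+ k + \sum_(i < k) c i * d ^+ (k - i) * s ^+ i)).
Proof.
move=> [M0 MB MM] [k [c Ec]] Msb; exists k, c.
have MD x y : M x -> M y -> M (x + y).
  by move=> Mx My; rewrite -[y]opprK -[- y]sub0r; apply: (MB) => //; apply: MB.
have Myk i : M (psi s ^+ i - (b * psi d) ^+ i) by rewrite subrXX mulrC; apply: MM.
rewrite -[X in M X](subrK ((b * psi d) ^+ k + \sum_(i < k) psi (c i * d ^+ (k - i)) * (b * psi d) ^+ i)).
apply: (MD).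
  rewrite rmorphD rmorphXn rmorph_sum opprD addrACA; apply: (MD) => //.
  rewrite -sumrB; elim/big_ind: _ => // i _.
  by rewrite rmorphM rmorphXn -mulrBr; apply: MM.
suff -> : (b * psi d) ^+ k + \sum_(i < k) psi (c i * d ^+ (k - i)) * (b * psi d) ^+ i = 0 by [].
transitivity (psi d ^+ k * (b ^+ k + \sum_(i < k) psi (c i) * b ^+ i)).
  rewrite mulrDr mulr_sumr; congr (_ + _).
    by rewrite exprMn mulrC.
  apply: eq_bigr => i _; rewrite rmorphM rmorphXn exprMn.
  have -> : psi d ^+ k = psi d ^+ (k - i) * psi d ^+ i by rewrite -exprD subnK // ltnW.
  by ring.
by rewrite Ec mulr0.
Qed.

Section Extension.
Variables (D E : comPzRingType) (C : closedFieldType).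
Variables (psi : {rmorphism D -> E}) (phi : {rmorphism D -> C}).
Hypothesis phi_surj : forall c, exists d, phi d = c.
Hypothesis ker_sub : forall d, psi d = 0 -> phi d = 0.
Hypothesis integralE : forall b : E, integral_over psi b.

Definition avoids (M : set E) := forall d, M (psi d) -> phi d = 0.

(** As for formally real subrings, the empty set stands for the union of the
    empty chain. *)
Lemma exists_max_avoiding : exists M : set E, [/\ is_ideal M, avoids M &
  forall N, is_ideal N -> avoids N -> M `<=` N -> N `<=` M].
Proof.
pose Q A := A = set0 \/ (is_ideal A /\ avoids A).
have [|M [QM maxM]] := @Zorn_bigcup _ Q.
  move=> F FQ Ftot.
  have [[A1 FA1 nA1]|none] := pselect (exists2 A, F A & A !=set0); last first.
    left; apply/seteqP; split=> // x [A FA Ax]; apply: none.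
    by exists A => //; exists x.
  have good A x : F A -> A x -> is_ideal A /\ avoids A.
    by move=> /FQ[->|].
  have join x y : (\bigcup_(X in F) X) x -> (\bigcup_(X in F) X) y ->
      exists A, [/\ F A, A x & A y].
    move=> [A FA Ax] [B FB By]; have [AB|BA] := Ftot _ _ FA FB.
      by exists B; split=> //; apply: AB.
    by exists A; split=> //; apply: BA.
  right; split; first split.
  - by have [x Ax] := nA1; have [[A0 _ _] _] := good _ _ FA1 Ax; exists A1.
  - move=> x y Ux Uy; have [A [FA Ax Ay]] := join _ _ Ux Uy.
    by have [[_ sA _] _] := good _ _ FA Ax; exists A => //; apply: sA.
  - move=> a x [A FA Ax]; have [[_ _ mA] _] := good _ _ FA Ax.
    by exists A => //; apply: mA.
  - by move=> d [A FA Ad]; have [_] := good _ _ FA Ad; apply.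
have id0 : is_ideal [set 0].
  split=> //; first by move=> x y /= -> ->; rewrite subrr.
  by move=> a x /= ->; rewrite mulr0.
have [M0|[idM avM]] := QM.
  have : M `<` [set 0].
    rewrite M0 properEneq; split=> //; apply/eqP => /seteqP[_ /(_ 0)]; exact.
  by move=> /maxM[]; right; split.
exists M; split=> // N idN avN MN; apply: contrapT => nNM.
by apply: (maxM N); [split|right].
Qed.

Section MaxAvoiding.
Variable M : set E.
Hypotheses (idM : is_ideal M) (avM : avoids M).
Hypothesis maxM : forall N, is_ideal N -> avoids N -> M `<=` N -> N `<=` M.

Let M0 : M 0. Proof. by case: idM. Qed.
Let MB x y : M x -> M y -> M (x - y). Proof. by case: idM => _ H _; apply: H. Qed.
Let MM a x : M x -> M (a * x). Proof. by case: idM => _ _ H; apply: H. Qed.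
Let MN x : M x -> M (- x). Proof. by move=> Mx; rewrite -sub0r; apply: MB. Qed.
Let MD x y : M x -> M y -> M (x + y).
Proof. by move=> Mx /MN My; rewrite -[y]opprK; apply: MB. Qed.

Lemma not_in_max x : ~ M x -> exists m e d, [/\ M m, m + e * x = psi d & phi d <> 0].
Proof.
move=> nMx; apply: contrapT => H; apply: nMx.
pose N : set E := [set u | exists m e, M m /\ u = m + e * x].
have NM : N `<=` M.
  apply: maxM.
  - split; first by exists 0, 0; rewrite mul0r addr0.
      move=> _ _ [m [e [Mm ->]]] [m' [e' [Mm' ->]]].
      exists (m - m'), (e - e'); split; first exact: MB.
      by ring.
    move=> a _ [m [e [Mm ->]]]; exists (a * m), (a * e); split; first exact: MM.
    by ring.
  - move=> d [m [e [Mm dE]]]; apply: contrapT => d0.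
    by apply: H; exists m, e, d.
  - by move=> m Mm; exists m, 0; rewrite mul0r addr0.
by apply: NM; exists 0, 1; rewrite mul1r add0r.
Qed.

(** If [psi d] is not in [M], maximality gives [psi s = b * psi d] modulo [M] with
    [phi s] nonzero, and [integral_congruence] gives [phi s ^+ k = 0]. *)
Lemma ker_in_max d : phi d = 0 -> M (psi d).
Proof.
move=> d0; apply: contrapT => /not_in_max[m [b [s [Mm E1 s0]]]].
have [|k [c /avM]] := integral_congruence (s := s) (d := d) idM (integralE b).
  by rewrite -E1 addrK.
rewrite rmorphD rmorph_sum big1 => [|i _].
  rewrite addr0 rmorphXn => /eqP; rewrite expf_eq0 => /andP[_ /eqP].
  exact: s0.
by rewrite !rmorphM rmorphXn d0 expr0n subn_eq0 leqNgt ltn_ord mulr0 mul0r.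
Qed.

Definition max_pred : {pred E} := [pred x | `[< M x >]].

Lemma max_zmod : zmod_closed max_pred.
Proof.
split; first exact/asboolP.
by move=> x y /asboolP Mx /asboolP My; apply/asboolP/MB.
Qed.
Lemma max_idealMl a : {in max_pred, forall u, a * u \in max_pred}.
Proof. by move=> u /asboolP Mu; apply/asboolP/MM. Qed.
Lemma max_neq1 : 1 \notin max_pred.
Proof.
apply/negP => /asboolP; rewrite -(rmorph1 psi) => /avM/eqP.
by rewrite rmorph1 oner_eq0.
Qed.
Lemma max_prime a b : a * b \in max_pred -> a \in max_pred \/ b \in max_pred.
Proof.
move=> /asboolP Mab; apply: contrapT => /not_orP[na nb].
have nMa : ~ M a by move=> H; apply/na/asboolP.
have nMb : ~ M b by move=> H; apply/nb/asboolP.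
have [m [e [d [Mm E1 d0]]]] := not_in_max nMa.
have [m' [e' [d' [Mm' E2 d'0]]]] := not_in_max nMb.
have /avM : M (psi (d * d')).
  rewrite rmorphM -E1 -E2 [X in M X](_ : _ = (m' + e' * b) * m + (e * a) * m' + (e * e') * (a * b)); last by ring.
  by apply: MD; [apply: MD|]; apply: MM.
rewrite rmorphM => /eqP; rewrite mulf_eq0 => /orP[]/eqP; exact.
Qed.
End MaxAvoiding.

(** A maximal ideal among those that [avoids] describes is prime and contains the
    image of the kernel of [phi], so [C] maps to the quotient domain.  That map
    is onto: an element of the quotient is a root of a monic polynomial over [C],
    which splits.  The extension is the inverse map. *)
Theorem extend_morphism : exists z : {rmorphism E -> C}, forall d, z (psi d) = phi d.
Proof.
have [M [idM avM maxM]] := exists_max_avoiding.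
pose P : primeIdeal E := HB.pack (max_pred M)
  (GRing.isZmodClosed.Build E (max_pred M) (max_zmod idM))
  (isIdealClosed.Build E (max_pred M) (max_idealMl idM))
  (isPrimeClosed.Build E (max_pred M) (max_neq1 avM) (max_prime idM avM maxM)).
have PE x : (x \in P) = `[< M x >] by [].
pose K : idomainType := domain_quotient P.
have jP : forall d d', phi d = phi d' -> domain_proj P (psi d) = domain_proj P (psi d').
  move=> d d' E1; apply/eqP; rewrite -subr_eq0 -rmorphB -rmorphB domain_proj_eq0 PE.
  by apply/asboolP/(ker_in_max idM avM maxM); rewrite rmorphB E1 subrr.
have /choice[sec secP] := phi_surj.
pose j c : K := domain_proj P (psi (sec c)).
have jphi d : j (phi d) = domain_proj P (psi d) by apply: jP; rewrite secP.
have j_zmod : zmod_morphism j.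
  by move=> x y; rewrite -[x]secP -[y]secP -rmorphB !jphi !rmorphB.
have j_monoid : monoid_morphism j.
  split; first by rewrite -(rmorph1 phi) jphi !rmorph1.
  by move=> x y; rewrite -[x]secP -[y]secP -rmorphM !jphi !rmorphM.
have [j' j'E] : exists j' : {rmorphism C -> K}, forall c, j' c = j c.
  by exists (HB.pack j (GRing.isZmodMorphism.Build _ _ j j_zmod)
    (GRing.isMonoidMorphism.Build _ _ j j_monoid) : {rmorphism C -> K}).
have surj b : exists c, j' c = domain_proj P b.
  have [k [c Ec]] := integralE b.
  pose g : {poly C} := 'X^k + \poly_(i < k) (if insub i is Some i' then phi (c i') else 0).
  have sg : size g = k.+1.
    by rewrite size_polyDl size_polyXn // ltnS size_poly.
  have gb : (map_poly j' g).[domain_proj P b] = 0.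
    rewrite rmorphD /= map_polyXn hornerD hornerXn.
    rewrite (@horner_coef_wide _ k); last first.
      by rewrite (leq_trans (size_poly _ _)) // size_poly.
    transitivity (domain_proj P (b ^+ k + \sum_(i < k) psi (c i) * b ^+ i)); last first.
      by rewrite Ec rmorph0.
    rewrite rmorphD rmorph_sum rmorphXn; congr (_ + _); apply: eq_bigr => i _.
    rewrite coef_map coef_poly ltn_ord insubT //= => lti.
    rewrite rmorphM rmorphXn; congr (_ * _).
    by rewrite j'E jphi; congr (domain_proj P (psi (c _))); apply: val_inj.
  have [r gE] := closed_field_poly_normal g.
  have g0 : lead_coef g != 0 by rewrite lead_coef_eq0 -size_poly_eq0 sg.
  move: gb; rewrite gE map_polyZ /= rmorph_prod /= hornerZ horner_prod => /eqP.
  rewrite mulf_eq0 fmorph_eq0 (negPf g0) /= prodf_seq_eq0 => /hasP[x _] /=.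
  rewrite rmorphB /= map_polyX map_polyC /= hornerXsubC subr_eq0 => /eqP bx.
  by exists x.
have /choice[z zP] := surj.
have j_inj : injective j' by exact: fmorph_inj.
have z_zmod : zmod_morphism z.
  by move=> x y; apply: j_inj; rewrite rmorphB /= !zP rmorphB.
have z_monoid : monoid_morphism z.
  split; first by apply: j_inj; rewrite zP !rmorph1.
  by move=> x y; apply: j_inj; rewrite rmorphM /= !zP rmorphM.
exists (HB.pack z (GRing.isZmodMorphism.Build _ _ z z_zmod)
  (GRing.isMonoidMorphism.Build _ _ z z_monoid) : {rmorphism E -> C}) => d /=.
by apply: j_inj; rewrite zP j'E jphi.
Qed.
End Extension.

(** The ring [B] with a square root of [-1] adjoined: on it, points with values
    in [R[i]] become surjective, as [extend_morphism] requires. *)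
Section Complexification.
Variable B : comPzRingType.

Definition cplx : Type := (B * B)%type.
HB.instance Definition _ := GRing.Zmodule.copy cplx (B * B)%type.

Definition cplx_one : cplx := (1, 0).
Definition cplx_mul (x y : cplx) : cplx := (x.1 * y.1 - x.2 * y.2, x.1 * y.2 + x.2 * y.1).
Lemma cplx_mulA : associative cplx_mul.
Proof. by case=> [a b] [c d] [e f]; rewrite /cplx_mul /=; congr (_, _); ring. Qed.
Lemma cplx_mulC : commutative cplx_mul.
Proof. by case=> [a b] [c d]; rewrite /cplx_mul /=; congr (_, _); ring. Qed.
Lemma cplx_mul1 : left_id cplx_one cplx_mul.
Proof. by case=> [a b]; rewrite /cplx_mul /=; congr (_, _); ring. Qed.
Lemma cplx_addE (x y : cplx) : x + y = (x.1 + y.1, x.2 + y.2) :> cplx.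
Proof. by []. Qed.
Lemma cplx_mulDl : left_distributive cplx_mul +%R.
Proof.
by case=> [a b] [c d] [e f]; rewrite !cplx_addE /cplx_mul /=; congr (_, _); ring.
Qed.
HB.instance Definition _ := GRing.Zmodule_isComPzRing.Build cplx
  cplx_mulA cplx_mulC cplx_mul1 cplx_mulDl.

Lemma cplx_mulE (x y : cplx) : x * y = cplx_mul x y. Proof. by []. Qed.

Definition cplx_in (b : B) : cplx := (b, 0).
Lemma cplx_in_zmod : zmod_morphism cplx_in.
Proof.
move=> a b; rewrite /cplx_in [RHS](_ : _ = (a - b, 0 - 0)) // subrr //.
Qed.
Lemma cplx_in_monoid : monoid_morphism cplx_in.
Proof.
split=> // a b; rewrite /cplx_in [RHS](_ : _ = cplx_mul (a, 0) (b, 0)) // /cplx_mul /=.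
by congr (_, _); ring.
Qed.
HB.instance Definition _ := GRing.isZmodMorphism.Build B cplx cplx_in cplx_in_zmod.
HB.instance Definition _ := GRing.isMonoidMorphism.Build B cplx cplx_in cplx_in_monoid.

Definition cplx_i : cplx := (0, 1).
Lemma cplxE (x : cplx) : x = cplx_in x.1 + cplx_i * cplx_in x.2.
Proof.
rewrite cplx_addE [cplx_i * _](_ : _ = cplx_mul (0, 1) (x.2, 0)) // /cplx_mul /=.
by case: x => a b /=; congr (_, _); ring.
Qed.
End Complexification.

Section ComplexifyMap.
Variables (D E : comPzRingType) (f : {rmorphism D -> E}).
Definition cplx_map (x : cplx D) : cplx E := (f x.1, f x.2).
Lemma cplx_map_zmod : zmod_morphism cplx_map.
Proof. by case=> [a b] [c d]; rewrite /cplx_map /= !rmorphB. Qed.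
Lemma cplx_map_monoid : monoid_morphism cplx_map.
Proof.
split; first by rewrite /cplx_map /= rmorph1 rmorph0.
move=> [a b] [c d]; rewrite /cplx_map [RHS](_ : _ = cplx_mul (f a, f b) (f c, f d)) //.
by rewrite /cplx_mul /= rmorphB rmorphD !rmorphM.
Qed.
HB.instance Definition _ := GRing.isZmodMorphism.Build (cplx D) (cplx E) cplx_map cplx_map_zmod.
HB.instance Definition _ := GRing.isMonoidMorphism.Build (cplx D) (cplx E) cplx_map cplx_map_monoid.

Lemma cplx_map_in d : cplx_map (cplx_in d) = cplx_in (f d).
Proof. by apply: (congr1 (pair (f d))); apply: (rmorph0 f). Qed.
Lemma cplx_map_i : cplx_map (@cplx_i D) = @cplx_i E.
Proof. by apply: congr2; [apply: (rmorph0 f)|apply: (rmorph1 f)]. Qed.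

Lemma cplx_map_integral : (forall b, integral_over f b) -> forall x, integral_over cplx_map x.
Proof.
move=> If x; apply/asboolP; rewrite -[`[< _ >]]/(x \in integral_elts cplx_map).
have Iin b : cplx_in b \in integral_elts cplx_map.
  apply/asboolP; have [n [c E1]] := If b; exists n, (fun i => cplx_in (c i)).
  transitivity (cplx_in (b ^+ n + \sum_(i < n) f (c i) * b ^+ i)); last by rewrite E1 rmorph0.
  rewrite rmorphD rmorphXn rmorph_sum; congr (_ + _).
  apply: eq_bigr => i _; rewrite rmorphM rmorphXn; congr (_ * _).
  exact: cplx_map_in.
have Ii : @cplx_i E \in integral_elts cplx_map.
  rewrite -cplx_map_i; apply/asboolP; exists 1%N, (fun=> - cplx_i D); rewrite big_ord1 expr1 expr0 mulr1.
  by rewrite rmorphN subrr.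
by rewrite [x]cplxE rpredD // rpredM.
Qed.
End ComplexifyMap.

Section CplxEval.
Variables (R : rcfType) (D : comPzRingType) (f : {rmorphism D -> R[i]}).
Definition cplx_eval (x : cplx D) : R[i] := f x.1 + 'i%C * f x.2.
Lemma cplx_eval_zmod : zmod_morphism cplx_eval.
Proof. by case=> [a b] [c d]; rewrite /cplx_eval /= !rmorphB; ring. Qed.
Lemma cplx_eval_monoid : monoid_morphism cplx_eval.
Proof.
split; first by rewrite /cplx_eval /= rmorph1 rmorph0 mulr0 addr0.
move=> [a b] [c d]; rewrite /cplx_eval cplx_mulE /cplx_mul /= rmorphB rmorphD !rmorphM.
have i2 : 'i%C * 'i%C = -1 :> R[i] by rewrite -expr2 sqr_i.
transitivity (f a * f c + 'i%C * 'i%C * (f b * f d) + 'i%C * (f a * f d + f b * f c)); last by ring.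
by rewrite i2; ring.
Qed.
HB.instance Definition _ := GRing.isZmodMorphism.Build (cplx D) R[i] cplx_eval cplx_eval_zmod.
HB.instance Definition _ := GRing.isMonoidMorphism.Build (cplx D) R[i] cplx_eval cplx_eval_monoid.
End CplxEval.

Theorem extend_complex (R : rcfType) (D B : comPzRingType)
    (psi : {rmorphism D -> B}) (phi : {rmorphism D -> R[i]}) :
  (forall r : R, exists d, phi d = (r%:C)%C) -> (forall d, psi d = 0 -> phi d = 0) ->
  (forall b, integral_over psi b) ->
  exists z : {rmorphism B -> R[i]}, forall d, z (psi d) = phi d.
Proof.
move=> phiR ker int_psi.
have [|||z zP] := @extend_morphism _ _ R[i] (cplx_map psi : {rmorphism cplx D -> cplx B})
   (cplx_eval phi : {rmorphism cplx D -> R[i]}).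
- case=> x y; have [a ax] := phiR x; have [b bY] := phiR y.
  exists (a, b); rewrite /= /cplx_eval /= ax bY.
  by rewrite [RHS]complexE.
- move=> [a b] /= [pa pb].
  by rewrite /cplx_eval /= !ker // mulr0 addr0.
- exact: cplx_map_integral.
exists (z \o @cplx_in B : {rmorphism B -> R[i]}) => d /=.
rewrite -[cplx_in _]/(@cplx_in B (psi d)) -cplx_map_in.
by rewrite zP /= /cplx_eval /= rmorph0 mulr0 addr0.
Qed.

(** * The residue of a function that is constant on fibres *)

(** By Vieta, the coefficient of degree [e] of [g] determines the single root. *)
Lemma single_root_power (C : closedFieldType) (g : {poly C}) (q : C) (e : nat) :
  size g = e.+2 -> (forall x, root g x -> x = q) ->
  ((lead_coef g *+ e.+1)%:P * 'X + (g`_e)%:P) ^+ e.+1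
  = ((lead_coef g ^+ e) *+ (e.+1 ^ e.+1)) *: g.
Proof.
move=> sg gq; have g0 : lead_coef g != 0 by rewrite lead_coef_eq0 -size_poly_eq0 sg.
have [r gE] := closed_field_poly_normal g.
have rq : {in r, forall x, x = q}.
  move=> x xr; apply: gq; rewrite gE rootZ // root_prod_XsubC //.
have sr : size r = e.+1.
  move: sg; rewrite {1}gE size_scale // size_prod_XsubC => -[] //.
have rE : r = nseq e.+1 q.
  by rewrite -sr; apply/all_pred1P/allP => x /rq ->; rewrite /= eqxx.
have prodE : \prod_(z <- r) ('X - z%:P) = ('X - q%:P) ^+ e.+1.
  by rewrite rE big_nseq iter_mulr_1.
have ge : g`_e = - (lead_coef g * q *+ e.+1).
  rewrite {1}gE coefZ.
  have := @coefPn_prod_XsubC _ r; rewrite sr => /(_ isT) ->.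
  by rewrite rE big_nseq iter_addr_0 mulrN mulrnAr.
have -> : (lead_coef g *+ e.+1)%:P * 'X + (g`_e)%:P = (lead_coef g *+ e.+1) *: ('X - q%:P).
  rewrite ge scalerBr -mul_polyC polyCN -mul_polyC -polyCM; congr (_ - _%:P).
  by rewrite mulrnAl.
have -> : ((lead_coef g ^+ e) *+ (e.+1 ^ e.+1)) *: g
  = ((lead_coef g ^+ e) *+ (e.+1 ^ e.+1)) *: (lead_coef g *: ('X - q%:P) ^+ e.+1).
  by rewrite -prodE -gE.
by rewrite exprZn scalerA mulrnAl -exprSr exprMn_n.
Qed.

Section FibreConstant.
Variables (R : rcfType) (n : nat) (P : primeIdeal {mpoly R[n]}).
Hypothesis realP : real_ideal P.
Variables (B : comNzRingType) (psi : {rmorphism {mpoly R[n]} -> B}) (p : B).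
Hypothesis int_psi : forall b, integral_over psi b.
Local Notation S := {mpoly R[n]}.
Hypothesis fibre_cst : forall v : 'I_n -> R, {in P, forall f, f.@[v] = 0} ->
  forall z1 z2 : {rmorphism B -> R[i]},
    (forall f, z1 (psi f) = (f.@[v])%:C%C) -> (forall f, z2 (psi f) = (f.@[v])%:C%C) ->
    z1 p = z2 p.

Definition eval_at_p : {rmorphism {poly S} -> B} := (horner_eval p \o map_poly psi).
Lemma eval_at_pE h : eval_at_p h = (map_poly psi h).[p]. Proof. by []. Qed.
Lemma eval_at_pC c : eval_at_p c%:P = psi c.
Proof. by rewrite eval_at_pE map_polyC hornerC. Qed.
Lemma eval_at_pB g h : eval_at_p (g - h) = eval_at_p g - eval_at_p h. Proof. exact: rmorphB. Qed.
Lemma eval_at_pD g h : eval_at_p (g + h) = eval_at_p g + eval_at_p h. Proof. exact: rmorphD. Qed.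
Lemma eval_at_pM g h : eval_at_p (g * h) = eval_at_p g * eval_at_p h. Proof. exact: rmorphM. Qed.
Lemma eval_at_pXn g k : eval_at_p (g ^+ k) = eval_at_p g ^+ k. Proof. exact: rmorphXn. Qed.
Lemma eval_at_pX : eval_at_p 'X = p. Proof. by rewrite eval_at_pE map_polyX hornerX. Qed.

Definition inP (h : {poly S}) := forall i, h`_i \in P.
Lemma inP0 : inP 0. Proof. by move=> i; rewrite coef0 rpred0. Qed.
Lemma inPB h h' : inP h -> inP h' -> inP (h - h').
Proof. by move=> H H' i; rewrite coefB rpredB. Qed.
Lemma inPM g h : inP h -> inP (g * h).
Proof. by move=> H i; rewrite coefM rpred_sum // => j _; rewrite idealMl. Qed.

(** Up to a factor outside [P], [h] is congruent modulo [P] to a relation of [p].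
    Over the fraction field of the residue ring of [P], these are the multiples
    of one polynomial. *)
Definition vanish (h : {poly S}) :=
  exists s w r, [/\ s \notin P, eval_at_p w = 0, inP r & s%:P * h = w + r].

Lemma notinP_mul s t : s \notin P -> t \notin P -> s * t \notin P.
Proof. by move=> Ps Pt; apply/negP => /prime_idealM[]; apply/negP. Qed.

Lemma vanishB h h' : vanish h -> vanish h' -> vanish (h - h').
Proof.
move=> [s [w [r [Ps w0 Pr E]]]] [s' [w' [r' [Ps' w'0 Pr' E']]]].
exists (s * s'), (s'%:P * w - s%:P * w'), (s'%:P * r - s%:P * r'); split.
- exact: notinP_mul.
- by rewrite eval_at_pB (eval_at_pM s'%:P w) (eval_at_pM s%:P w') !eval_at_pC w0 w'0 !mulr0 subrr.
- by apply: inPB; apply: inPM.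
- rewrite mulrBr polyCM mulrAC [X in X - _]mulrC -[X in _ - X]mulrA E E' mulrC.
  by ring.
Qed.

Lemma vanishM g h : vanish h -> vanish (g * h).
Proof.
move=> [s [w [r [Ps w0 Pr E]]]]; exists s, (g * w), (g * r); split=> //.
- by rewrite eval_at_pM w0 mulr0.
- exact: inPM.
- by rewrite mulrCA E mulrDr.
Qed.

Lemma vanish_inP r : inP r -> vanish r.
Proof.
move=> Pr; exists 1, 0, r; split=> //; first exact: prime_ideal1.
  exact: (rmorph0 eval_at_p).
by rewrite mul1r add0r.
Qed.
Lemma vanish_ev w : eval_at_p w = 0 -> vanish w.
Proof.
move=> w0; exists 1, w, 0; split=> //; first exact: prime_ideal1.
  exact: inP0.
by rewrite mul1r addr0.
Qed.

(** An integral equation of [p] is monic, so its coefficients are not all in [P].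
    A leading coefficient in [P] could be removed, against minimality. *)
Lemma exists_min_vanish : exists h0, [/\ vanish h0, lead_coef h0 \notin P &
  forall h, vanish h -> (size h < size h0)%N -> inP h].
Proof.
have exm : exists m, `[< exists h, [/\ vanish h, ~ inP h & size h = m] >].
  have [k [c Ec]] := int_psi p.
  pose h : {poly S} := 'X^k + \sum_(i < k) (c i)%:P * 'X^i.
  exists (size h); apply/asboolP; exists h; split=> //.
    apply: vanish_ev; rewrite /h eval_at_pD (rmorph_sum eval_at_p) eval_at_pXn -[RHS]Ec eval_at_pX; congr (_ + _); apply: eq_bigr => i _.
    by rewrite eval_at_pM eval_at_pXn eval_at_pX eval_at_pC.
  move=> /(_ k); rewrite coefD coefXn eqxx coef_sum big1 ?addr0.
    by apply/negP; exact: prime_ideal1.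
  by move=> i _; rewrite coefCM coefXn gtn_eqF ?mulr0.
case: (ex_minnP exm) => m /asboolP[h0 [v0 nP0 sh0]] minm.
have minh h : vanish h -> (size h < size h0)%N -> inP h.
  move=> vh sh; apply: contrapT => nPh.
  have /minm : `[< exists g, [/\ vanish g, ~ inP g & size g = size h] >].
    by apply/asboolP; exists h.
  by rewrite -sh0 leqNgt sh.
exists h0; split=> //; apply/negP => lP; apply: (nP0).
have h00 : h0 != 0.
  by apply/negP => /eqP h00; move: nP0; rewrite h00; case; exact: inP0.
have lt : inP (lead_coef h0 *: 'X^((size h0).-1)).
  by move=> i; rewrite coefZ coefXn mulr_natr rpredMn.
rewrite -[h0](subrK (lead_coef h0 *: 'X^((size h0).-1))) -[X in _ + X]opprK.
apply: inPB; last by rewrite -sub0r; apply: inPB => //; exact: inP0.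
apply: minh; first by apply: vanishB => //; apply: vanish_inP.
have s0 : (0 < size h0)%N by rewrite size_poly_gt0.
rewrite -[X in (_ < X)%N](prednK s0) ltnS; apply/leq_sizeP => j hj.
rewrite coefB coefZ coefXn; move: hj; rewrite leq_eqVlt => /predU1P[<-|hj].
  by rewrite eqxx mulr1 subrr.
rewrite gtn_eqF // mulr0 subr0 nth_default //.
by rewrite -(prednK s0).
Qed.

(** Pseudo-division by [h0] shows that a relation of [p] specialized at [v]
    vanishes at [xi]: the remainder is in [P] by minimality, and the leading
    coefficient of [h0] is invertible at [v]. *)
Lemma vanish_point h0 v xi : vanish h0 -> lead_coef h0 \notin P ->
  (forall h, vanish h -> (size h < size h0)%N -> inP h) ->
  {in P, forall f, f.@[v] = 0} -> (lead_coef h0).@[v] != 0 ->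
  root (map_poly (real_complex R \o meval v) h0) xi ->
  exists2 z : {rmorphism B -> R[i]}, forall f, z (psi f) = (f.@[v])%:C%C & z p = xi.
Proof.
move=> v0 nl minh Pv lv rxi.
pose ev : {rmorphism S -> R[i]} := (real_complex R \o meval v).
have [phi phiE] : exists phi : {rmorphism {poly S} -> R[i]},
    forall h, phi h = (map_poly ev h).[xi].
  by exists (horner_eval xi \o map_poly ev : {rmorphism {poly S} -> R[i]}).
have [|||z zP] := @extend_complex R _ _ eval_at_p phi.
- move=> r; exists (r%:MP)%:P; rewrite phiE map_polyC hornerC /=.
  by rewrite mevalC.
- move=> h hw; have h00 : h0 != 0.
    by apply: contraNneq nl => ->; rewrite lead_coef0 rpred0.
  have := rdivp_eq h0 h; set k := rscalp _ _; set q := rdivp _ _; set r := rmodp _ _.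
  move=> E; have Pr : inP r.
    apply: minh; last by rewrite ltn_rmodpN0.
    have -> : r = (lead_coef h0 ^+ k)%:P * h - q * h0 by rewrite mul_polyC E addrC addKr.
    by apply: vanishB; apply: vanishM => //; apply: vanish_ev.
  have : phi (lead_coef h0 ^+ k *: h) = 0.
    rewrite E rmorphD rmorphM [phi h0]phiE (eqP rxi) mulr0 add0r phiE.
    rewrite (_ : map_poly ev r = 0) ?horner0 //; apply/polyP => i.
    by rewrite coef_map coef0 /= Pv // rmorph0.
  rewrite -mul_polyC rmorphM => /eqP; rewrite mulf_eq0 => /orP[|/eqP //].
  rewrite phiE map_polyC hornerC /= rmorphXn rmorphXn expf_eq0 fmorph_eq0.
  by rewrite (negPf lv) andbF.
- move=> b; have [k [c Ec]] := int_psi b; exists k, (fun i => (c i)%:P).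
  by rewrite -[RHS]Ec; congr (_ + _); apply: eq_bigr => i _; rewrite eval_at_pC.
exists z => [f|]; first by rewrite -eval_at_pC zP phiE map_polyC hornerC.
by rewrite -eval_at_pX zP phiE map_polyX hornerX.
Qed.

(** The fraction [a / s] is the residue of [p] common to all primes [N] over [P];
    the factor [s1] is the one that the definition of [vanish] allows. *)
Theorem fibre_constant_residue : exists a s s1, [/\ s \notin P, s1 \notin P &
  forall N : primeIdeal B, {in P, forall f, psi f \in N} -> psi s1 \notin N ->
    psi s * p - psi a \in N].
Proof.
have [h0 [v0 nl minh]] := exists_min_vanish.
have vanishN h (N : primeIdeal B) s w r : inP r -> s%:P * h = w + r -> eval_at_p w = 0 ->
    {in P, forall f, psi f \in N} -> psi s \notin N -> eval_at_p h \in N.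
  move=> Pr E w0 PN sN; have : psi s * eval_at_p h \in N.
    rewrite -eval_at_pC -eval_at_pM E eval_at_pD w0 add0r eval_at_pE horner_coef rpred_sum // => i _.
    by rewrite mulrC idealMl // coef_map PN.
  by move=> /prime_idealM[] //; rewrite (negPf sN).
have h00 : h0 != 0.
  by apply: contraNneq nl => ->; rewrite lead_coef0 rpred0.
case sh0: (size h0) => [|[|e]].
- by move/eqP: sh0; rewrite size_poly_eq0 (negPf h00).
- have [s [w [r [Ps w0 Pr E]]]] := v0.
  have hC : h0 = (lead_coef h0)%:P.
    by rewrite [LHS]size1_polyC ?sh0 // lead_coefE sh0.
  exists 0, 1, (s * lead_coef h0); split; [exact: prime_ideal1|exact: notinP_mul|].
  move=> N PN; rewrite rmorphM => slN; case/negP: (slN); apply: idealMl.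
  rewrite -eval_at_pC -hC; apply: (vanishN _ _ _ _ _ Pr E w0 PN).
  by apply: contra slN => sN; rewrite mulrC idealMl.
set s0 := lead_coef h0 in nl *.
pose D := (((s0 *+ e.+1)%:P * 'X + (h0`_e)%:P) ^+ e.+1 - ((s0 ^+ e) *+ (e.+1 ^ e.+1)) *: h0).
(* the coefficients of D vanish at the real points of P where s0 does not *)
have PD : inP D.
  move=> i; apply/negPn/negP => nPD.
  have [v Pv] := real_nullstellensatz realP (notinP_mul nl nPD).
  rewrite mevalM mulf_eq0 negb_or => /andP[lv /negP]; apply.
  pose ev : {rmorphism S -> R[i]} := (real_complex R \o meval v).
  have evl : ev s0 != 0 by rewrite /= fmorph_eq0.
  pose g := map_poly ev h0.
  have lg : lead_coef g = ev s0 by rewrite /g lead_coef_map_eq.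
  have sg : size g = e.+2 by rewrite /g size_map_poly_id0 ?sh0.
  have rt x : root g x -> exists2 z : {rmorphism B -> R[i]},
      forall f, z (psi f) = (f.@[v])%:C%C & z p = x.
    exact: vanish_point.
  have [|q gq] := closed_rootP g _; first by rewrite sg.
  have [z zv zp] := rt q gq.
  have uniq_root x : root g x -> x = q.
    by move=> /rt[z' z'v <-]; rewrite -zp; apply: (fibre_cst Pv).
  have := single_root_power sg uniq_root.
  move=> /eqP; rewrite -subr_eq0 => /eqP E0.
  suff H : map_poly ev D = 0.
    have : ev D`_i = 0 by rewrite -coef_map H coef0.
    by move=> /= /eqP; rewrite fmorph_eq0.
  rewrite -E0 /D rmorphB rmorphXn rmorphD rmorphM /= map_polyX !map_polyC /= map_polyZ.
  rewrite !rmorphMn rmorphXn lg coef_map //.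
have vD : vanish (((s0 *+ e.+1)%:P * 'X + (h0`_e)%:P) ^+ e.+1).
  rewrite -[X in vanish X](subrK (((s0 ^+ e) *+ (e.+1 ^ e.+1)) *: h0)) -/D.
  rewrite -[X in _ + X]opprK; apply: vanishB; first exact: vanish_inP.
  by rewrite -scaleNr -mul_polyC; apply: vanishM.
have [s1 [w [r [Ps1 w0 Pr E]]]] := vD.
exists (- h0`_e), (s0 *+ e.+1), s1; split=> //.
  apply: contra nl => H; have -> : s0 = (e.+1%:R^-1)%:MP * (s0 *+ e.+1).
    rewrite -[s0 *+ _]mulr_natl -mpolyC_nat mulrA -mpolyCM mulVf ?mul1r //.
    by rewrite pnatr_eq0.
  exact: idealMl.
move=> N PN s1N; have := vanishN _ _ _ _ _ Pr E w0 PN s1N.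
rewrite eval_at_pXn eval_at_pD eval_at_pM !eval_at_pC eval_at_pX rmorphN opprK.
elim: (e.+1 in X in _ ^+ X) => [|k IH].
  by move=> N1; case/negP: (@prime_ideal1 _ N).
by rewrite exprS => /prime_idealM[].
Qed.
End FibreConstant.

(** * Localization at a real prime *)
Section MaximalIdeal.
Variables (A : comPzRingType) (M : ideal A).
Hypothesis maxM : maximal_ideal M.

Lemma maximal_comaximal x : x \notin M -> exists m e, m \in M /\ m + e * x = 1.
Proof.
move=> nMx; apply: contrapT => none; case/negP: nMx; have [M1 max] := maxM.
pose J : {pred A} := [pred y | `[< exists m e, m \in M /\ m + e * x = y >]].
have JZ : zmod_closed J.
  split; first by apply/asboolP; exists 0, 0; rewrite rpred0 mul0r addr0.
  move=> y y' /asboolP[m [e [Mm <-]]] /asboolP[m' [e' [Mm' <-]]]; apply/asboolP.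
  exists (m - m'), (e - e'); split; first exact: rpredB.
  by ring.
have JI a : {in J, forall u, a * u \in J}.
  move=> y /asboolP[m [e [Mm <-]]]; apply/asboolP; exists (a * m), (a * e).
  by split; [exact: idealMl|ring].
pose JJ : ideal A := HB.pack J (GRing.isZmodClosed.Build A J JZ) (isIdealClosed.Build A J JI).
apply: (max JJ).
- by apply/negP => /asboolP.
- by move=> m Mm; apply/asboolP; exists m, 0; rewrite mul0r addr0.
- by apply/asboolP; exists 0, 1; rewrite rpred0 add0r mul1r.
Qed.

Lemma maximal_prime x y : x * y \in M -> x \in M \/ y \in M.
Proof.
move=> Mxy; have [|nMx] := boolP (x \in M); [by left|right].
have [m [e [Mm E]]] := maximal_comaximal nMx.
rewrite -[y]mul1r -E mulrDl rpredD //; first by rewrite mulrC idealMl.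
by rewrite -mulrA idealMl.
Qed.

Lemma maximal_unit x y : y * x = 1 -> x \notin M.
Proof. by move=> E; apply/negP => /(idealMl (s := M) y); rewrite E; apply/negP; case: maxM. Qed.

Lemma ideal_is_ideal : is_ideal [set x | x \in M].
Proof.
split=> /=; first exact: rpred0.
  by move=> x y; apply: rpredB.
by move=> a x; apply: idealMl.
Qed.
End MaximalIdeal.

Section FibreLocalization.
Variables (A B : comPzRingType) (f : {rmorphism A -> B}) (P : primeIdeal A).
Local Notation BP := (localization (image_mset f (prime_compl P))).
Local Notation loc := (@to_loc B (image_mset f (prime_compl P))).

Definition fdenom s (sP : s \notin P) : denom (image_mset f (prime_compl P)) :=
  map_denom f (exist _ s sP : denom (prime_compl P)).

Lemma loc_unit s (sP : s \notin P) : frac 1 (fdenom sP) * loc (f s) = 1.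
Proof. by rewrite /to_loc fracM frac1; apply: frac_eq => /=; ring. Qed.

Lemma denomP (t : denom (image_mset f (prime_compl P))) :
  exists2 s, s \notin P & f s = sval t.
Proof. by case: t => t /= /asboolP[s sP E]; exists s. Qed.

Lemma frac_locE b t : loc (sval t) * frac b t = loc b :> BP.
Proof. by rewrite /to_loc fracM; apply: frac_eq => /=; ring. Qed.

Hypothesis int_f : forall b, integral_over f b.
Variable M : ideal BP.
Hypothesis maxM : maximal_ideal M.

(** If [x] is a unit modulo [M], [integral_congruence] puts in [M] the image of an
    element congruent modulo [P] to a power of [s], hence a unit. *)
Lemma maximal_over x : x \in P -> loc (f x) \in M.
Proof.
move=> Px; apply/negPn/negP => nM.
have [m [e [Mm E1]]] := maximal_comaximal maxM nM.
have [b [t eE]] : exists b t, e = frac b t by exists (loc_repr e).1, (loc_repr e).2; rewrite frac_repr.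
have [s sP st] := denomP t.
pose psi : {rmorphism A -> BP} := (loc \o f).
have int_b : integral_over psi (loc b).
  have [n [c Ec]] := int_f b; exists n, c.
  transitivity (loc (b ^+ n + \sum_(i < n) f (c i) * b ^+ i)); last by rewrite Ec rmorph0.
  rewrite rmorphD rmorphXn rmorph_sum; congr (_ + _).
  by apply: eq_bigr => i _; rewrite rmorphM rmorphXn.
have [|k [c /= Mk]] := integral_congruence (s := s) (d := x) (ideal_is_ideal M) int_b.
  rewrite /= st -(frac_locE b t) -eE -mulrA -{1}[loc (sval t)]mulr1 -E1 -mulrBr.
  by rewrite addrK idealMl.
have nP : s ^+ k + \sum_(i < k) c i * x ^+ (k - i) * s ^+ i \notin P.
  have PS : \sum_(i < k) c i * x ^+ (k - i) * s ^+ i \in P.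
    apply: rpred_sum => i _; rewrite mulrC idealMl // idealMl //.
    have : (0 < k - i)%N by rewrite subn_gt0.
    by case: (k - i)%N => // l _; rewrite exprSr idealMl.
  apply/negP => H; have : s ^+ k \in P by rewrite -(addrK (\sum_(i < k) c i * x ^+ (k - i) * s ^+ i) (s ^+ k)) rpredB.
  elim: (k) => [|l IH]; first by move=> P1; case/negP: (@prime_ideal1 _ P).
  by rewrite exprS => /prime_idealM[] //; apply/negP.
by have /negP := maximal_unit maxM (loc_unit nP).
Qed.
End FibreLocalization.

(** In this section [P] is the kernel of the composite of [f] with a complex
    point [z] of [B]. *)
Section Kernel.
Variables (R : rcfType) (A B : comPzRingType) (f : {rmorphism A -> B}) (P : primeIdeal A).
Variable z : {rmorphism B -> R[i]}.
Hypothesis zP : forall a, (a \in P) = (z (f a) == 0).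
Hypothesis zR : forall r : R, exists a, z (f a) = (r%:C)%C.
Local Notation BP := (localization (image_mset f (prime_compl P))).
Local Notation loc := (@to_loc B (image_mset f (prime_compl P))).

Lemma eval_mset_neq0 u : u \in image_mset f (prime_compl P) -> z u != 0.
Proof. by move=> /asboolP[s sP <-]; rewrite -zP. Qed.

(** The kernel of the extension of [z] to the localization, described without
    constructing that extension. *)
Definition ker_loc : {pred BP} := [pred x | `[< exists b t, x = frac b t /\ z b = 0 >]].

Lemma ker_locP b t : (frac b t : BP) \in ker_loc -> z b = 0.
Proof.
move=> /asboolP[b' [t' [/fracP[u Su E] zb']]].
move/(congr1 z): E; rewrite !rmorphM zb' mul0r mulr0 => /eqP.
rewrite !mulf_eq0 (negPf (eval_mset_neq0 Su)) (negPf (eval_mset_neq0 (svalP t'))) orbF => /eqP //.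
Qed.

Lemma ker_loc_zmod : zmod_closed ker_loc.
Proof.
split; first by apply/asboolP; exists 0, (denom1 _); rewrite rmorph0.
elim/fracW=> a s; elim/fracW=> b t /ker_locP za /ker_locP zb; apply/asboolP.
rewrite fracN fracD; do 2 eexists; split; first reflexivity.
by rewrite rmorphD !rmorphM rmorphN za zb oppr0 !mul0r addr0.
Qed.

Lemma ker_loc_ideal x : {in ker_loc, forall u, x * u \in ker_loc}.
Proof.
elim/fracW: x => a s; elim/fracW=> b t /ker_locP zb; apply/asboolP.
rewrite fracM; do 2 eexists; split; first reflexivity.
by rewrite rmorphM zb mulr0.
Qed.

(** The kernel of [z] is a maximal ideal: an element of nonzero complex value
    satisfies, modulo the kernel, a real quadratic equation with nonzero constant
    term, so it generates the unit ideal. *)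
Lemma jacobson_kernel b t : jacobson_radical (frac b t : BP) -> z b = 0.
Proof.
pose N : ideal BP := HB.pack ker_loc
  (GRing.isZmodClosed.Build BP ker_loc ker_loc_zmod)
  (isIdealClosed.Build BP ker_loc ker_loc_ideal).
move=> /(_ N) H; apply: (@ker_locP b t); apply: H; split.
  by apply/negP => /ker_locP/eqP; rewrite rmorph1 oner_eq0.
move=> J J1 NJ x; elim/fracW: x => c u Jx; apply/asboolP; exists c, u; split=> //.
apply: contrapT => zc; case/negP: J1.
have Jc : loc c \in J by rewrite -(frac_locE c u) idealMl.
case Ez: (z c) => [x y].
have [a1 E1] := zR (x *+ 2); have [a0 E0] := zR (x ^+ 2 + y ^+ 2).
have a0P : a0 \notin P.
  rewrite zP E0 fmorph_eq0 paddr_eq0 ?sqr_ge0 // !sqrf_eq0; apply/negP => /andP[/eqP x0 /eqP y0].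
  by apply: zc; rewrite Ez x0 y0.
have Jq : loc (c ^+ 2 - f a1 * c + f a0) \in J.
  apply: NJ; apply/asboolP; do 2 eexists; split; first reflexivity.
  rewrite rmorphD rmorphB rmorphXn (rmorphM z) E1 E0 Ez.
  by apply/eqP; rewrite eq_complex /=; apply/andP; split; apply/eqP; ring.
have Ja0 : loc (f a0) \in J.
  have -> : f a0 = (c ^+ 2 - f a1 * c + f a0) - (c - f a1) * c by ring.
  by rewrite rmorphB rmorphM rpredB // idealMl.
by rewrite -(loc_unit f a0P) idealMl.
Qed.

Lemma Rplus_value p a s t b :
  loc p = frac (f a) (map_denom f s) + frac b t :> BP -> z b = 0 ->
  z p * z (f (sval s)) = z (f a).
Proof.
rewrite fracD => /fracP[u Su E] zb; move/(congr1 z): E; rewrite /= !rmorphM.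
rewrite rmorphD !rmorphM zb mul0r addr0 rmorph1 mulr1 => E'.
apply: (mulIf (eval_mset_neq0 (svalP t))); apply: (mulfI (eval_mset_neq0 Su)).
by rewrite -mulrA E'.
Qed.
End Kernel.

(** * Functions on the normalization *)
Lemma preim_prime (S A : comPzRingType) (q : {rmorphism S -> A}) (P : primeIdeal A) :
  exists P' : primeIdeal S, forall a, (a \in P') = (q a \in P).
Proof.
pose P' : {pred S} := [pred a | q a \in P].
have Z : zmod_closed P'.
  split; first by rewrite inE /= rmorph0 rpred0.
  by move=> a b; rewrite !inE /= rmorphB => Pa Pb; rewrite rpredB.
have Id a : {in P', forall u, a * u \in P'}.
  by move=> u; rewrite !inE /= rmorphM => Pu; rewrite idealMl.
have one : 1 \notin P' by rewrite inE /= rmorph1 prime_ideal1.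
have pr a b : a * b \in P' -> a \in P' \/ b \in P'.
  by rewrite !inE /= rmorphM => /prime_idealM.
by exists (HB.pack P' (GRing.isZmodClosed.Build S P' Z) (isIdealClosed.Build S P' Id)
   (isPrimeClosed.Build S P' one pr) : primeIdeal S).
Qed.

Section Variety.
Variables (R : realType) (n : nat) (I : ideal {mpoly R[n]}).
Local Notation S := {mpoly R[n]}.
Local Notation A := (coord_ring I).
Local Notation q := (quot_proj I : {rmorphism S -> A}).
Local Notation f := (norm_map I).

Lemma norm_eval_real (z : norm_complex_point I) v :
  norm_proj z = (fun i => real_complex R (v i)) ->
  forall g : S, z (f (q g)) = real_complex R g.@[v].
Proof.
move=> zv g; elim/mpoly_ring_ind: g => [c|i|g h IHg IHh|g h IHg IHh].
- by rewrite norm_eval_const mevalC.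
- by rewrite mevalXU -[RHS](congr1 (fun F => F i) zv).
- by rewrite !rmorphD /= IHg IHh.
- by rewrite !rmorphM /= IHg IHh.
Qed.

Lemma coord_ring_surj (a : A) : exists g, q g = a.
Proof. by eexists; apply: quot_proj_surj. Qed.

Lemma Rplus_fibre_constant p : Rseminormalization I p ->
  forall z1 z2 : norm_complex_point I,
      complexified_real_points I (norm_proj z1) ->
      complexified_real_points I (norm_proj z2) ->
      norm_proj z1 = norm_proj z2 -> z1 p = z2 p.
Proof.
move=> Rp z1 z2 [v _ z1v] _ z12; rewrite z1v in z12.
have z1E := norm_eval_real z1v; have z2E := norm_eval_real (esym z12).
have [P PE] : exists P : primeIdeal A, forall a, (a \in P) = (z1 (f a) == 0).
  pose zero : {pred R[i]} := pred1 0.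
  have Z : zmod_closed zero.
    by split; rewrite ?inE //= => x y; rewrite !inE => /eqP -> /eqP ->; rewrite subrr.
  have Id a : {in zero, forall u, a * u \in zero}.
    by move=> u; rewrite !inE => /eqP ->; rewrite mulr0.
  have one : 1 \notin zero by rewrite inE oner_eq0.
  have pr a b : a * b \in zero -> a \in zero \/ b \in zero.
    by rewrite !inE mulf_eq0 => /orP.
  pose Z0 : primeIdeal R[i] := HB.pack zero (GRing.isZmodClosed.Build _ zero Z)
    (isIdealClosed.Build _ zero Id) (isPrimeClosed.Build _ zero one pr).
  have [P PE] := preim_prime (z1 \o f : {rmorphism A -> R[i]}) Z0.
  by exists P => a; rewrite PE inE.
have PqE g : (q g \in P) = (g.@[v] == 0) by rewrite PE z1E fmorph_eq0.
have realP : real_ideal P.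
  move=> s; rewrite PE rmorph_sum rmorph_sum => s0 a ain.
  have /choice[h hE] := coord_ring_surj.
  have : \sum_(b <- s) ((h b).@[v]) ^+ 2 == 0.
    rewrite -(fmorph_eq0 (real_complex R)) rmorph_sum; apply/eqP; rewrite -[RHS](eqP s0).
    by apply: eq_bigr => b _; rewrite -[b in RHS]hE !rmorphXn /= z1E.
  rewrite psumr_eq0 => [/allP/(_ _ ain)/=|b _]; last exact: sqr_ge0.
  by rewrite sqrf_eq0 -PqE hE.
have [x [y yJ E]] := Rp P realP.
have [a [s xE]] : exists a s, x = frac a s.
  by exists (loc_repr x).1, (loc_repr x).2; rewrite frac_repr.
have [b [t yE]] : exists b t, y = frac b t.
  by exists (loc_repr y).1, (loc_repr y).2; rewrite frac_repr.
rewrite xE yE loc_map_frac in E; rewrite yE in yJ.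
have zE12 c : z2 (f c) = z1 (f c) by have [g <-] := coord_ring_surj c; rewrite z1E z2E.
have PE2 c : (c \in P) = (z2 (f c) == 0) by rewrite zE12.
have zR (z : norm_complex_point I) (r : R) : exists c, z (f c) = (r%:C)%C.
  by exists (q r%:MP); rewrite norm_eval_const.
have e1 := Rplus_value PE E (jacobson_kernel PE (zR z1) yJ).
have e2 := Rplus_value PE2 E (jacobson_kernel PE2 (zR z2) yJ).
have s0 : z1 (f (sval s)) != 0 by rewrite -PE; exact: (svalP s).
by apply: (mulIf s0); rewrite e1 -(zE12 (sval s)) e2 zE12.
Qed.

Lemma fibre_constant_Rplus p :
  (forall z1 z2 : norm_complex_point I,
      complexified_real_points I (norm_proj z1) ->
      complexified_real_points I (norm_proj z2) ->
      norm_proj z1 = norm_proj z2 -> z1 p = z2 p) -> Rseminormalization I p.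
Proof.
move=> cst P realP.
have [P' P'E] := preim_prime q P.
have realP' : real_ideal P'.
  move=> s; rewrite P'E rmorph_sum => sP a ain; rewrite P'E.
  apply: (realP [seq q b | b <- s]); last exact: map_f.
  rewrite big_map (_ : \sum_(b <- s) q b ^+ 2 = \sum_(b <- s) q (b ^+ 2)) //.
  by apply: eq_bigr => b _; rewrite rmorphXn.
have A0 : (1 : A) != 0.
  by apply: contraNneq (@prime_ideal1 _ P) => ->; rewrite rpred0.
have B0 : (1 : norm_ring I) != 0.
  apply: contraNneq A0 => B0; apply/eqP; apply: (@to_normalization_inj A).
  by rewrite rmorph0 rmorph1.
pose B : comNzRingType := HB.pack (GRing.ComPzRing.sort (norm_ring I))
    (GRing.PzSemiRing_isNonZero.Build (GRing.ComPzRing.sort (norm_ring I)) B0).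
pose psi : {rmorphism S -> B} := (f \o q).
have int_psi b : integral_over psi b.
  have [k [c E]] := @to_normalization_integral A b.
  have /choice[h hE] := coord_ring_surj.
  by exists k, (fun i => h (c i)); rewrite -[RHS]E; congr (_ + _); apply: eq_bigr => i _;
    rewrite /psi /= hE.
have fib (v : 'I_n -> R) : {in P', forall g, g.@[v] = 0} ->
  forall z1 z2 : {rmorphism B -> R[i]},
    (forall g, z1 (psi g) = (g.@[v])%:C%C) -> (forall g, z2 (psi g) = (g.@[v])%:C%C) ->
    z1 (p : B) = z2 (p : B).
  move=> P'v z1 z2 z1v z2v.
  have pt (z : {rmorphism B -> R[i]}) : (forall g, z (psi g) = (g.@[v])%:C%C) ->
     exists2 x : norm_complex_point I, norm_proj x = (fun i => real_complex R (v i)) & x p = z p.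
    move=> zv; have zc (c : R) : (z : {rmorphism norm_ring I -> R[i]}) (f (q c%:MP)) = real_complex R c.
      by rewrite -[LHS]/(z (psi c%:MP)) zv mevalC.
    exists (NormComplexPoint zc) => //; apply/funext => i.
    by rewrite /norm_proj -[LHS]/(z (psi 'X_i)) zv mevalXU.
  have rv : real_points I v.
    move=> g gI; apply: P'v; rewrite P'E.
    have -> : q g = 0 by rewrite -(rmorph0 q); apply/quot_projP; rewrite subr0.
    exact: rpred0.
  have [x1 x1v <-] := pt _ z1v; have [x2 x2v <-] := pt _ z2v.
  apply: cst; last by rewrite x1v x2v.
    by exists v.
  by exists v.
have [a [s [s1 [sP s1P core]]]] := fibre_constant_residue realP' int_psi fib.
rewrite P'E in sP; rewrite P'E in s1P.
pose ds : denom (prime_compl P) := exist _ (q s) sP.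
pose mS := image_mset f (prime_compl P).
exists (frac (q a) ds), (to_loc mS p - loc_map f (frac (q a) ds)); last by rewrite addrC subrK.
move=> M maxM.
pose N : {pred B} := [pred b | to_loc mS b \in M].
have NZ : zmod_closed N.
  split; first by rewrite inE /= rmorph0 rpred0.
  by move=> b c; rewrite !inE /= rmorphB => Nb Nc; rewrite rpredB.
have NI b : {in N, forall u, b * u \in N}.
  by move=> u; rewrite !inE /= rmorphM => Nu; rewrite idealMl.
have N1 : 1 \notin N by rewrite inE /= rmorph1; case: maxM.
have Npr b c : b * c \in N -> b \in N \/ c \in N.
  by rewrite !inE /= rmorphM => /(maximal_prime maxM).
pose N' : primeIdeal B := HB.pack N (GRing.isZmodClosed.Build B N NZ)
  (isIdealClosed.Build B N NI) (isPrimeClosed.Build B N N1 Npr).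
have N'P : {in P', forall g, psi g \in N'}.
  move=> g; rewrite P'E => gP.
  exact: (maximal_over (@to_normalization_integral A) maxM gP).
have N's1 : psi s1 \notin N' by exact: (maximal_unit maxM (loc_unit f s1P)).
have H : to_loc mS (f (q s) * p - f (q a)) \in M by exact: (core N' N'P N's1).
have -> : to_loc mS p - loc_map f (frac (q a) ds)
   = frac 1 (fdenom f sP) * to_loc mS (f (q s) * p - f (q a)).
  rewrite loc_map_frac /to_loc fracN fracD fracM; apply: frac_eq => /=; ring.
exact: idealMl.
Qed.
End Variety.

Theorem proposition3p2 (R : realType) (n : nat) (I : ideal {mpoly R[n]})
    (I_real : real_ideal I) :
  Rseminormalization I =
  [set p : norm_ring I |
    forall z1 z2 : norm_complex_point I,
      complexified_real_points I (norm_proj z1) ->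
      complexified_real_points I (norm_proj z2) ->
      norm_proj z1 = norm_proj z2 -> z1 p = z2 p].
Proof.
apply/seteqP; split=> p; first exact: Rplus_fibre_constant.
exact: fibre_constant_Rplus.
Qed.
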